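(* Let $n\ge 1$ and let $H=-\Delta+V$ be the Schrödinger operator on $L^2(\mathbb R^n)$ defined in the context, where $V\in W^{1,\infty}_{\mathrm{loc}}(\mathbb R^n)$ is complex-valued and satisfies $\operatorname{Re}V\ge 0$, $|\nabla V|^2\le a+b|V|^2$ for some $a,b>0$, $|V(x)|\to\infty$ as $|x|\to\infty$, and $\operatorname{Re}V(x)\ge c|x|^2-d$ for some constants $c,d>0$. Then for every $\delta>0$ and $R>0$ there exists an $\varepsilon>0$ such that $$\sigma_\varepsilon(H)\subset\{z\in\mathbb C:\operatorname{Re}z\ge R\}\cup\bigcup_{\lambda\in\sigma(H)}\{z\in\mathbb C:|z-\lambda|<\delta\}.$$
   Context: $L^2(\mathbb R^n)=L^2(\mathbb R^n,\mathbb C)$. The operator $H$ is the closure in $L^2(\mathbb R^n)$ of $-\Delta+V$ defined on $C_0^\infty(\mathbb R^n)$. Under the stated hypotheses on $V$ it is known that this closure exists and has domain $\mathcal D(H)=H^2(\mathbb R^n)\cap\{\psi\in L^2(\mathbb R^n):V\psi\in L^2(\mathbb R^n)\}$, is m-accretive, and has compact resolvent. For a closed operator $A$ and $\varepsilon>0$, the $\varepsilon$-pseudospectrum is $\sigma_\varepsilon(A):=\sigma(A)\cup\{z\in\rho(A):\|(z-A)^{-1}\|>1/\varepsilon\}$. *)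

(* Defs.v *)
From HB Require Import structures.
From mathcomp Require Import all_boot all_order all_algebra.
From mathcomp Require Import complex.
From mathcomp Require Import all_classical all_reals all_analysis.
From mathcomp Require Import measurable_realfun.

Set Implicit Arguments.
Unset Strict Implicit.
Unset Printing Implicit Defensive.

Import Order.TTheory GRing.Theory Num.Theory.
Import numFieldNormedType.Exports.
Import ComplexField.Normc.

Local Open Scope classical_set_scope.
Local Open Scope ring_scope.
Local Open Scope complex_scope.
Local Open Scope quotient_scope.

Section complex_functions.
Context (R : realType) (d : measure_display) (T : measurableType d).
Implicit Types f g : T -> R[i].

Definition cmeasurable f :=
  measurable_fun setT (@complex.Re R \o f) /\ measurable_fun setT (@complex.Im R \o f).

(* Every use below is for integrable f; Rintegral is total. *)
Definition cintegral (mu : {measure set T -> \bar R}) f : R[i] :=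
  Rintegral mu setT (@complex.Re R \o f) +i* Rintegral mu setT (@complex.Im R \o f).

Lemma normcE (z : R[i]) : `|z| = (normc z)%:C.
Proof. by []. Qed.

Lemma normc_ge0 (z : R[i]) : 0 <= normc z.
Proof. by case: z => a b; exact: sqrtr_ge0. Qed.

Lemma ler_normcD (z w : R[i]) : normc (z + w) <= normc z + normc w.
Proof. by rewrite -lecR rmorphD /= -!normcE ler_normD. Qed.

Lemma cmeasurable_normc f :
  cmeasurable f -> measurable_fun setT ((@normc R) \o f).
Proof.
move=> [mr mi]; rewrite (_ : _ \o f =
    @Num.sqrt R \o (fun x => complex.Re (f x) ^+ 2 + complex.Im (f x) ^+ 2)); last first.
  by apply/funext => x /=; case: (f x).
apply: measurableT_comp.
  apply: continuous_measurable_fun; exact: sqrt_continuous.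
by apply: measurable_funD; apply: measurable_funX.
Qed.

Lemma cmeasurable0 : cmeasurable 0.
Proof. by split; exact: measurable_cst. Qed.

Lemma cmeasurableD f g : cmeasurable f -> cmeasurable g -> cmeasurable (f + g).
Proof.
move=> [fr fi] [gr gi]; split.
  rewrite (_ : _ \o _ = (@complex.Re R \o f) \+ (@complex.Re R \o g)); last first.
    by apply/funext => x /=; rewrite raddfD.
  exact: measurable_funD.
rewrite (_ : _ \o _ = (@complex.Im R \o f) \+ (@complex.Im R \o g)); last first.
  by apply/funext => x /=; rewrite raddfD.
exact: measurable_funD.
Qed.

Lemma cmeasurableZ (a : R[i]) f :
  cmeasurable f -> cmeasurable (fun x => a * f x).
Proof.
move=> [fr fi]; split.
  rewrite (_ : _ \o _ =
      (cst (complex.Re a) \* (@complex.Re R \o f)) \-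
      (cst (complex.Im a) \* (@complex.Im R \o f))); last first.
    by apply/funext => x /=; case: (f x) => ? ?; case: a.
  by apply: measurable_funB; apply: measurable_funM => //; exact: measurable_cst.
rewrite (_ : _ \o _ =
    (cst (complex.Re a) \* (@complex.Im R \o f)) \+
    (cst (complex.Im a) \* (@complex.Re R \o f))); last first.
  by apply/funext => x /=; case: (f x) => ? ?; case: a.
by apply: measurable_funD; apply: measurable_funM => //; exact: measurable_cst.
Qed.

End complex_functions.

Section L2_functions.
Context (R : realType) (d : measure_display) (T : measurableType d).
Variable mu : {measure set T -> \bar R}.
Local Notation C := R[i].
Implicit Types f g : T -> C.

Local Notation N f := ('N[mu]_2%:E[EFin \o (@normc R \o f)])%E.

Definition square_integrable f :=
  cmeasurable f /\ finite_norm mu 2%:E (@normc R \o f).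

Lemma Lnorm_le (u v : T -> R) :
  measurable_fun setT u -> measurable_fun setT v ->
  (forall x, 0 <= u x <= v x) ->
  ('N[mu]_2%:E[EFin \o u] <= 'N[mu]_2%:E[EFin \o v])%E.
Proof.
move=> mu_ mv uv; rewrite unlock; apply: gt0_ler_poweR.
- by rewrite invr_ge0.
- by rewrite in_itv /= leey integral_ge0// => x _; exact: poweR_ge0.
- by rewrite in_itv /= leey integral_ge0// => x _; exact: poweR_ge0.
have mp (w : T -> R) : measurable_fun setT w ->
    measurable_fun setT (fun x => `|(EFin \o w) x| `^ 2)%E.
  move=> mw; apply/measurable_EFinP.
  apply/(@measurableT_comp _ _ _ _ _ _ (fun x : R => x `^ 2)%R) => //.
  exact/measurableT_comp.
apply: ge0_le_integral => //; try exact: mp.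
- by move=> x _; exact: poweR_ge0.
move=> x _ /=; have /andP[u0 uv_] := uv x.
rewrite lee_fin ge0_ler_powR ?nnegrE//.
by rewrite !ger0_norm// (le_trans u0).
Qed.

Lemma L2NZ (a : C) f : cmeasurable f ->
  (N (fun x => a * f x)%R = (normc a)%:E * N f)%E.
Proof.
move=> mf.
rewrite (_ : _ \o _ = EFin \o (fun x => normc a * normc (f x))%R); last first.
  by apply/funext => x /=; rewrite normcM.
have mn := cmeasurable_normc mf.
rewrite unlock.
under eq_integral => x _.
  rewrite /= normrM powRM ?normr_ge0// EFinM; over.
have mp : measurable_fun setT (fun x => (`|normc (f x)| `^ 2)%:E).
  apply/measurable_EFinP.
  apply/(@measurableT_comp _ _ _ _ _ _ (fun x : R => x `^ 2)%R) => //.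
  exact/measurableT_comp.
rewrite (ge0_integralZl _ measurableT mp); last 2 first.
- by move=> x _; rewrite lee_fin powR_ge0.
- by rewrite lee_fin powR_ge0.
rewrite poweRM ?lee_fin ?powR_ge0//; last first.
  by apply: integral_ge0 => x _; rewrite lee_fin powR_ge0.
rewrite poweR_EFin -powRrM mulfV ?powRr1 ?normr_ge0 ?pnatr_eq0//.
by rewrite ger0_norm// normc_ge0.
Qed.

Lemma L2ND f g : cmeasurable f -> cmeasurable g ->
  (N (f + g)%R <= N f + N g)%E.
Proof.
move=> mf mg.
have mnf := cmeasurable_normc mf; have mng := cmeasurable_normc mg.
apply: le_trans (minkowski_EFin _ mnf mng _); last by rewrite ler1n.
apply: Lnorm_le.
- exact/cmeasurable_normc/cmeasurableD.
- exact: measurable_funD.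
by move=> x; rewrite normc_ge0 /= ler_normcD.
Qed.

Lemma L2N0 : N 0%R = 0%E.
Proof.
rewrite (_ : _ \o _ = cst 0%E); first by rewrite Lnorm0// eqe pnatr_eq0.
by apply/funext => x; congr EFin; exact: normc0.
Qed.

Definition L2pred : {pred T -> C} := fun f => `[< square_integrable f >].

Lemma L2pred_submod_closed : submod_closed L2pred.
Proof.
split.
  apply/asboolP; split; first exact: cmeasurable0.
  by rewrite /finite_norm L2N0.
move=> a f g /asboolP[mf nf] /asboolP[mg ng]; apply/asboolP; split.
  by apply: cmeasurableD => //; exact: cmeasurableZ.
rewrite /finite_norm (le_lt_trans (L2ND _ _))//; first exact: cmeasurableZ.
by rewrite L2NZ// lte_add_pinfty// lte_mul_pinfty ?lee_fin ?normc_ge0.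
Qed.

HB.instance Definition _ :=
  GRing.isSubmodClosed.Build _ _ L2pred L2pred_submod_closed.

Record L2fun := MkL2fun { L2fun_fun :> T -> C; L2funP : L2fun_fun \in L2pred }.
HB.instance Definition _ := [isSub for L2fun_fun].
HB.instance Definition _ := [Choice of L2fun by <:].
HB.instance Definition _ := [SubChoice_isSubLmodule of L2fun by <:].

Definition L2norm (f : L2fun) : R := fine (N f).

Lemma L2normE (f : L2fun) : (L2norm f)%:E = N f.
Proof.
rewrite /L2norm fineK// ge0_fin_numE ?Lnorm_ge0//.
by have /asboolP[] := L2funP f.
Qed.

Lemma L2fun_meas (f : L2fun) : cmeasurable f.
Proof. by have /asboolP[] := L2funP f. Qed.

Lemma L2norm_ge0 (f : L2fun) : 0 <= L2norm f.
Proof. by rewrite -lee_fin L2normE Lnorm_ge0. Qed.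

Lemma L2normD (f g : L2fun) : L2norm (f + g) <= L2norm f + L2norm g.
Proof. by rewrite -lee_fin EFinD !L2normE L2ND//; exact: L2fun_meas. Qed.

Lemma L2normZ (a : C) (f : L2fun) : L2norm (a *: f) = normc a * L2norm f.
Proof. by apply: EFin_inj; rewrite EFinM !L2normE -L2NZ//; exact: L2fun_meas. Qed.

Lemma L2norm_eq0 (f : L2fun) : L2norm f = 0 <-> {ae mu, forall x, f x = 0}.
Proof.
have mn := cmeasurable_normc (L2fun_meas f).
split.
  move=> f0; have := L2normE f; rewrite f0 => /esym/Lnorm_eq0_eq0 h.
  have {}h := h (iffRL (measurable_EFinP _ _) mn) ltac:(by rewrite lte_fin).
  by apply: filterS h => x /(_ I) [] /eq0_normc.
move=> f0; apply: EFin_inj; rewrite L2normE -[RHS]L2N0 unlock.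
congr (_ `^ _)%E; apply: ae_eq_integral => //.
- apply/measurable_EFinP.
  apply/(@measurableT_comp _ _ _ _ _ _ (fun x : R => x `^ 2)%R) => //.
  exact/measurableT_comp.
- apply/measurable_EFinP.
  apply/(@measurableT_comp _ _ _ _ _ _ (fun x : R => x `^ 2)%R) => //.
  exact/measurableT_comp/(cmeasurable_normc (cmeasurable0 _ _)).
- by apply: filterS f0 => x /= -> _.
Qed.

End L2_functions.

Section L2_space.
Context (R : realType) (d : measure_display) (T : measurableType d).
Variable mu : {measure set T -> \bar R}.
Local Notation C := R[i].
Local Notation L2fun := (L2fun mu).

Definition L2_ae_eq (f g : L2fun) := `[< {ae mu, forall x, f x = g x} >].

Lemma L2_ae_eqE f g : L2_ae_eq f g <-> L2norm (f - g) = 0.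
Proof.
rewrite L2norm_eq0; split.
  by move=> /asboolP; apply: filterS => x /= fg; apply/eqP; rewrite subr_eq0 fg.
by move=> h; apply/asboolP; apply: filterS h => x /= /eqP; rewrite subr_eq0 => /eqP.
Qed.

Let L2_ae_eq_refl : reflexive L2_ae_eq.
Proof. by move=> f; apply/asboolP; exact: nearW. Qed.

Let L2_ae_eq_sym : symmetric L2_ae_eq.
Proof.
by move=> f g; apply/idP/idP => /asboolP h; apply/asboolP; apply: filterS h.
Qed.

Let L2_ae_eq_trans : transitive L2_ae_eq.
Proof.
move=> f g h /asboolP gf /asboolP fh; apply/asboolP.
by apply: filterS2 gf fh => x -> ->.
Qed.

Canonical L2_ae_eq_equiv :=
  EquivRel L2_ae_eq L2_ae_eq_refl L2_ae_eq_sym L2_ae_eq_trans.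

Definition L2 : Type := {eq_quot L2_ae_eq}.
HB.instance Definition _ := Choice.on L2.
HB.instance Definition _ := EqQuotient.on L2.

Definition L2_to_fun (u : L2) : T -> C := (repr u : L2fun).
Coercion L2_to_fun : L2 >-> Funclass.

Definition L2class (f : L2fun) : L2 := \pi_L2 f.

Lemma L2classP (f g : L2fun) : L2class f = L2class g <-> L2_ae_eq f g.
Proof. by split => [/eqmodP|h]; last exact/eqmodP. Qed.

Lemma L2reprK (u : L2) : L2class (repr u) = u.
Proof. exact: reprK. Qed.

Lemma L2repr_class (f : L2fun) : L2_ae_eq (repr (L2class f)) f.
Proof. by apply/L2classP; rewrite L2reprK. Qed.

Lemma L2funDE (f g : L2fun) x : (f + g) x = f x + g x. Proof. by []. Qed.
Lemma L2funNE (f : L2fun) x : (- f) x = - f x. Proof. by []. Qed.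
Lemma L2funZE a (f : L2fun) x : (a *: f) x = a * f x. Proof. by []. Qed.

Definition L2add (u v : L2) : L2 := L2class (repr u + repr v).
Definition L2opp (u : L2) : L2 := L2class (- repr u).
Definition L2scale (a : C) (u : L2) : L2 := L2class (a *: repr u).

Lemma L2addE f g : L2add (L2class f) (L2class g) = L2class (f + g).
Proof.
apply/L2classP/asboolP.
have /asboolP := L2repr_class f; have /asboolP := L2repr_class g.
by apply: filterS2 => x gx fx; rewrite !L2funDE gx fx.
Qed.

Lemma L2oppE f : L2opp (L2class f) = L2class (- f).
Proof.
by apply/L2classP/asboolP; have /asboolP := L2repr_class f; apply: filterS => x fx; rewrite !L2funNE fx.
Qed.

Lemma L2scaleE a f : L2scale a (L2class f) = L2class (a *: f).
Proof.
by apply/L2classP/asboolP; have /asboolP := L2repr_class f; apply: filterS => x fx; rewrite !L2funZE fx.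
Qed.

Let L2addA : associative L2add.
Proof.
by move=> u v w; rewrite -[u]L2reprK -[v]L2reprK -[w]L2reprK !L2addE addrA.
Qed.

Let L2addC : commutative L2add.
Proof. by move=> u v; rewrite -[u]L2reprK -[v]L2reprK !L2addE addrC. Qed.

Let L2add0 : left_id (L2class 0) L2add.
Proof. by move=> u; rewrite -[u]L2reprK L2addE add0r. Qed.

Let L2addN : left_inverse (L2class 0) L2opp L2add.
Proof. by move=> u; rewrite -[u]L2reprK L2oppE L2addE addNr. Qed.

HB.instance Definition _ :=
  GRing.isZmodule.Build L2 L2addA L2addC L2add0 L2addN.

Lemma L2class_is_zmod_morphism : zmod_morphism L2class.
Proof. by move=> f g; rewrite -L2addE -L2oppE. Qed.

HB.instance Definition _ :=
  GRing.isZmodMorphism.Build L2fun L2 L2class L2class_is_zmod_morphism.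

Let L2scaleA a b (u : L2) : L2scale a (L2scale b u) = L2scale (a * b) u.
Proof. by rewrite -[u]L2reprK !L2scaleE scalerA. Qed.

Let L2scale1 : left_id 1 L2scale.
Proof. by move=> u; rewrite -[u]L2reprK L2scaleE scale1r. Qed.

Let L2scaleDr : right_distributive L2scale +%R.
Proof.
move=> a u v; rewrite -[u]L2reprK -[v]L2reprK -raddfD !L2scaleE.
by rewrite scalerDr raddfD.
Qed.

Let L2scaleDl (u : L2) : {morph L2scale^~ u : a b / a + b}.
Proof.
by move=> a b; rewrite -[u]L2reprK !L2scaleE scalerDl raddfD.
Qed.

HB.instance Definition _ := GRing.Zmodule_isLmodule.Build C L2
  L2scaleA L2scale1 L2scaleDr L2scaleDl.

Lemma L2class_is_scalable : scalable L2class.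
Proof. by move=> a f; rewrite -L2scaleE. Qed.

HB.instance Definition _ :=
  GRing.isScalable.Build C L2fun L2 *:%R L2class L2class_is_scalable.

Definition L2norm_class (u : L2) : C := (L2norm (repr u))%:C.

Lemma L2norm_classE (f : L2fun) : L2norm_class (L2class f) = (L2norm f)%:C.
Proof.
congr (_ %:C); apply: EFin_inj; rewrite !L2normE unlock.
congr (_ `^ _)%E; apply: ae_eq_integral => //.
- apply/measurable_EFinP.
  apply/(@measurableT_comp _ _ _ _ _ _ (fun x : R => x `^ 2)%R) => //.
  exact/measurableT_comp/cmeasurable_normc/L2fun_meas.
- apply/measurable_EFinP.
  apply/(@measurableT_comp _ _ _ _ _ _ (fun x : R => x `^ 2)%R) => //.
  exact/measurableT_comp/cmeasurable_normc/L2fun_meas.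
by have /asboolP := L2repr_class f; apply: filterS => x /= ->.
Qed.

Let ler_L2normD (u v : L2) :
  L2norm_class (u + v) <= L2norm_class u + L2norm_class v.
Proof.
rewrite -[u]L2reprK -[v]L2reprK -raddfD !L2norm_classE -rmorphD lecR.
exact: L2normD.
Qed.

Let L2norm_classZ (a : C) (u : L2) :
  L2norm_class (a *: u) = `|a| * L2norm_class u.
Proof.
by rewrite -[u]L2reprK -linearZ !L2norm_classE L2normZ rmorphM normcE.
Qed.

Let L2norm_class_eq0 (u : L2) : L2norm_class u = 0 -> u = 0.
Proof.
rewrite -[u]L2reprK L2norm_classE => -[h].
rewrite -[RHS](raddf0 L2class); apply/L2classP/L2_ae_eqE.
by rewrite subr0.
Qed.

HB.instance Definition _ := Lmodule_isNormed.Build C L2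
  ler_L2normD L2norm_classZ L2norm_class_eq0.

Lemma normL2E (f : L2fun) : `|L2class f| = (L2norm f)%:C.
Proof. exact: L2norm_classE. Qed.

End L2_space.

Section measurable_rV.
Context (R : realType) (n : nat).

Definition rV_display : measure_display. Proof. exact: default_measure_display. Qed.

Definition rV_coord (i : 'I_n) (x : 'rV[R]_n) : measurableTypeR R := x 0 i.

Let rV_set0 : g_sigma_preimage rV_coord set0.
Proof. exact: sigma_algebra0. Qed.

Let rV_setC A : g_sigma_preimage rV_coord A -> g_sigma_preimage rV_coord (~` A).
Proof. exact: sigma_algebraC. Qed.

Let rV_bigcup (F : (set _)^nat) : (forall i, g_sigma_preimage rV_coord (F i)) ->
  g_sigma_preimage rV_coord (\bigcup_i (F i)).
Proof. exact: sigma_algebra_bigcup. Qed.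

(* The Borel sigma-algebra of R^n, generated by the coordinate functions. *)
HB.instance Definition _ := @isMeasurable.Build rV_display 'rV[R]_n
  (g_sigma_preimage rV_coord) rV_set0 rV_setC rV_bigcup.

Lemma measurable_rV_coord i :
  measurable_fun [set: 'rV[R]_n] (fun x : 'rV[R]_n => x 0 i : measurableTypeR R).
Proof.
move=> _ Y mY; rewrite setTI; apply: sub_sigma_algebra => /=.
rewrite -bigcup_seq/=; exists i => /=; first by rewrite mem_index_enum.
by exists Y => //; rewrite setTI.
Qed.

Lemma measurable_fun_rVP d (T : measurableType d) (f : T -> 'rV[R]_n) :
  (forall i, measurable_fun [set: T] (fun x => f x 0 i : measurableTypeR R)) ->
  measurable_fun [set: T] f.
Proof.
move=> mf.
suff : g_sigma_preimage (fun i => rV_coord i \o f) `<=` measurable.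
  by rewrite g_sigma_preimage_comp => h _ A mA; apply: h; exists A.
apply: smallest_sub; first exact: sigma_algebra_measurable.
rewrite -bigcup_seq; apply: bigcup_sub => i _.
by move=> A [B mB <-]; exact: mf.
Qed.

End measurable_rV.

Section lebesgue_rV.
Context (R : realType).
Local Open Scope ereal_scope.

Definition rV_cons n (p : measurableTypeR R * 'rV[R]_n) : 'rV[R]_n.+1 :=
  row_mx (p.1%:M : 'rV[R]_1) p.2.

Lemma rV_cons0 n p : (@rV_cons n p) 0%R ord0 = p.1.
Proof.
rewrite /rV_cons (_ : ord0 = lshift n (ord0 : 'I_1)); last exact/val_inj.
by rewrite (row_mxEl (p.1%:M : 'rV[R]_1)) mxE eqxx.
Qed.

Lemma rV_consS n p i : (@rV_cons n p) 0%R (lift ord0 i) = p.2 0%R i.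
Proof.
rewrite /rV_cons (_ : lift ord0 i = rshift 1 i); last exact/val_inj.
by rewrite (row_mxEr (p.1%:M : 'rV[R]_1)).
Qed.

Lemma measurable_rV_cons n : measurable_fun setT (@rV_cons n).
Proof.
apply: measurable_fun_rVP => i; case: (unliftP ord0 i) => [j|] ->.
  under eq_fun do rewrite rV_consS.
  exact: (measurableT_comp (measurable_rV_coord j) measurable_snd).
under eq_fun do rewrite rV_cons0.
exact: measurable_fst.
Qed.

Fixpoint lebesgue_rV n : set 'rV[R]_n -> \bar R :=
  match n with
  | 0 => \d_(0%R : 'rV[R]_0)
  | m.+1 =>
    pushforward (@lebesgue_measure R \x lebesgue_rV (n := m)) (@rV_cons m)
  end.

Let box n (a b : 'I_n -> R) : set 'rV[R]_n :=
  [set x | forall i, x 0%R i \in `[a i, b i]%R].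

Let measurable_box n (a b : 'I_n -> R) : measurable (box a b).
Proof.
rewrite (_ : box a b = \bigcap_(i in [set: 'I_n])
    ((fun x : 'rV[R]_n => x 0%R i : measurableTypeR R) @^-1` `[a i, b i])).
  apply: fin_bigcap_measurable => // i _.
  rewrite -[X in measurable X]setTI.
  by apply: measurable_rV_coord => //; exact: measurable_itv.
by apply/seteqP; split => x /= h i; [move=> _|]; have := h i => //; exact.
Qed.

Section step.
Context (n : nat) (mu : {sigma_finite_measure set 'rV[R]_n -> \bar R}).
Hypothesis mu_box : forall a b, (forall i, a i <= b i)%R ->
  mu (box a b) = (\prod_(i < n) (b i - a i))%R%:E.

Let nu : set 'rV[R]_n.+1 -> \bar R :=
  pushforward (@lebesgue_measure R \x mu) (@rV_cons n).

Let mnu A : measurable A -> measurable (@rV_cons n @^-1` A).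
Proof.
by move=> mA; rewrite -[X in measurable X]setTI; exact: measurable_rV_cons.
Qed.

Let nu0 : nu set0 = 0.
Proof. by rewrite /nu /pushforward preimage_set0 measure0. Qed.

Let nu_ge0 A : 0 <= nu A.
Proof. by rewrite /nu /pushforward; exact: measure_ge0. Qed.

Let nu_sigma_additive : semi_sigma_additive nu.
Proof.
move=> F mF tF mUF; rewrite /nu /pushforward preimage_bigcup.
apply: measure_semi_sigma_additive.
- by move=> k; exact: mnu.
- apply/trivIsetP => /= i j _ _ ij; rewrite -preimage_setI.
  by move/trivIsetP : tF => /(_ _ _ _ _ ij) ->//; rewrite preimage_set0.
- by rewrite -preimage_bigcup; exact: mnu.
Qed.

HB.instance Definition _ :=
  isMeasure.Build _ _ _ nu nu0 nu_ge0 nu_sigma_additive.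

Let nu_box a b : (forall i, a i <= b i)%R ->
  nu (box a b) = (\prod_(i < n.+1) (b i - a i))%R%:E.
Proof.
move=> ab; rewrite /nu /pushforward.
rewrite (_ : _ @^-1` _ = `[a ord0, b ord0] `*`
    box (fun i => a (lift ord0 i)) (fun i => b (lift ord0 i))); last first.
  apply/seteqP; split => p.
    move=> h; split => /=; first by have := h ord0; rewrite rV_cons0.
    by move=> i; have := h (lift ord0 i); rewrite rV_consS.
  move=> [h0 h] i; case: (unliftP ord0 i) => [j|] ->.
    by rewrite rV_consS; exact: h.
  by rewrite rV_cons0.
rewrite product_measure1E//; last exact: measurable_box.
rewrite mu_box// big_ord_recl EFinM; congr (_ * _).
rewrite -[LHS]/(lebesgue_measure `[a ord0, b ord0]) lebesgue_measure_itv/= lte_fin.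
by case: ltgtP (ab ord0) => // -> _; rewrite subrr.
Qed.

Let nu_sigma_finite : sigma_finite setT nu.
Proof.
exists (fun k : nat => box (fun=> - k%:R)%R (fun=> k%:R)%R).
  apply/esym/seteqP; split => // x _.
  pose M := (\sum_i `|x 0 i|)%R.
  exists (Num.truncn M).+1 => // i.
  rewrite in_itv /= -ler_norml (@le_trans _ _ M)//.
    by rewrite /M (bigD1 i)//= lerDl sumr_ge0.
  by apply: ltW; rewrite truncnS_gt.
move=> k; split; first exact: measurable_box.
by rewrite nu_box ?ltry// => i; rewrite ge0_cp.
Qed.

HB.instance Definition _ := Measure_isSigmaFinite.Build _ _ _ nu nu_sigma_finite.

Lemma lebesgue_rV_step :
  exists2 nu : {sigma_finite_measure set 'rV[R]_n.+1 -> \bar R},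
  pushforward (@lebesgue_measure R \x mu) (@rV_cons n) = nu &
  forall a b, (forall i, a i <= b i)%R ->
    nu (box a b) = (\prod_(i < n.+1) (b i - a i))%R%:E.
Proof. by exists nu. Qed.

End step.

Let lebesgue_rV_spec n :
  exists2 mu : {sigma_finite_measure set 'rV[R]_n -> \bar R},
  @lebesgue_rV n = mu & forall a b, (forall i, a i <= b i)%R ->
    mu (box a b) = (\prod_(i < n) (b i - a i))%R%:E.
Proof.
elim: n => [|n [mu muE muB]].
  exists (dirac (0%R : 'rV[R]_0)) => // a b ab.
  rewrite big_ord0 -[LHS]/(\d_(0%R : 'rV[R]_0) (box a b)) diracE mem_set//.
  by case.
by rewrite /= muE; exact: lebesgue_rV_step.
Qed.

Section instances.
Context (n : nat).

Let lebesgue_rV0 : @lebesgue_rV n set0 = 0.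
Proof. by have [mu -> _] := lebesgue_rV_spec n. Qed.

Let lebesgue_rV_ge0 A : 0 <= @lebesgue_rV n A.
Proof. by have [mu -> _] := lebesgue_rV_spec n. Qed.

Let lebesgue_rV_sigma_additive : semi_sigma_additive (@lebesgue_rV n).
Proof.
have [mu -> _] := lebesgue_rV_spec n; exact: measure_semi_sigma_additive.
Qed.

HB.instance Definition _ := isMeasure.Build _ _ _ (@lebesgue_rV n)
  lebesgue_rV0 lebesgue_rV_ge0 lebesgue_rV_sigma_additive.

Let lebesgue_rV_sigma_finite : sigma_finite setT (@lebesgue_rV n).
Proof. have [mu -> _] := lebesgue_rV_spec n; exact: sigma_finiteT. Qed.

HB.instance Definition _ := Measure_isSigmaFinite.Build _ _ _ (@lebesgue_rV n)
  lebesgue_rV_sigma_finite.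

Lemma lebesgue_rV_box (a b : 'I_n -> R) : (forall i, a i <= b i)%R ->
  lebesgue_rV [set x : 'rV[R]_n | forall i, x 0%R i \in `[a i, b i]%R] =
  (\prod_(i < n) (b i - a i))%R%:E.
Proof. by have [mu -> h] := lebesgue_rV_spec n; exact: h. Qed.

End instances.

End lebesgue_rV.
Arguments lebesgue_rV : clear implicits.

(* An unbounded operator A in E is given by its graph: A (u, v) means that
   u is in the domain of A and that v = A u. *)
Section spectrum.
Context (R : realType) (E : normedModType R[i]).
Implicit Types (A : set (E * E)) (z : R[i]) (B : {linear E -> E}).

(* Norms in E are R[i]-valued, with zero imaginary part. *)
Definition opnorm (B : E -> E) : \bar R :=
  ereal_sup [set (complex.Re `|B x|)%:E | x in [set x : E | `|x| <= 1]].

(* B = (z - A)^-1 is an everywhere defined bounded operator: (z - A) B f = f for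
   all f, and B (z - A) u = u for all u in the domain of A. *)
Definition is_resolvent A z B :=
  [/\ continuous B,
      forall f, A (B f, z *: B f - f) &
      forall u v, A (u, v) -> B (z *: u - v) = u].

Definition resolvent_set A : set R[i] := [set z | exists B, is_resolvent A z B].

Definition spectrum A : set R[i] := ~` resolvent_set A.

Definition pseudospectrum A (e : R) : set R[i] :=
  spectrum A `|`
  [set z | exists2 B : {linear E -> E}, is_resolvent A z B &
                                        ((e^-1)%:E < opnorm B)%E].

End spectrum.

Section schrodinger.
Context (R : realType) (n : nat).
Local Notation C := R[i].
Local Notation Rn := 'rV[R]_n.
Local Notation leb := (lebesgue_rV R n).

(* The library's norm on row vectors is the sup norm. *)
Definition enorm (x : Rn) : R := Num.sqrt (\sum_i x 0 i ^+ 2).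

Definition pderiv (i : 'I_n) (f : Rn -> R) : Rn -> R :=
  fun x => 'D_(delta_mx 0 i) f x.

Fixpoint Ck (k : nat) (f : Rn -> R) : Prop :=
  continuous f /\
  if k is k'.+1 then
    forall i, (forall x, derivable f x (delta_mx 0 i)) /\ Ck k' (pderiv i f)
  else True.

Definition smooth (f : Rn -> R) := forall k, Ck k f.

Definition test_function (phi : Rn -> C) :=
  [/\ smooth (@complex.Re R \o phi), smooth (@complex.Im R \o phi) &
      compact (closure [set x | phi x != 0])].

Definition cpderiv (i : 'I_n) (phi : Rn -> C) : Rn -> C :=
  fun x => pderiv i (@complex.Re R \o phi) x +i* pderiv i (@complex.Im R \o phi) x.

Definition laplacian (phi : Rn -> C) : Rn -> C :=
  fun x => \sum_i cpderiv i (cpderiv i phi) x.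

Definition Linfty_loc (f : Rn -> C) :=
  cmeasurable f /\
  forall K, compact K ->
    exists M : R, {ae leb, forall x, K x -> normc (f x) <= M}.

(* V belongs to W^{1,oo}_loc(R^n), with weak gradient gradV *)
Definition W1infty_loc (V : Rn -> C) (gradV : 'I_n -> Rn -> C) :=
  Linfty_loc V /\
  forall i, Linfty_loc (gradV i) /\
    forall phi, test_function phi ->
      cintegral leb (fun x => V x * cpderiv i phi x) =
      - cintegral leb (fun x => gradV i x * phi x).

Definition schrodinger_core (V : Rn -> C) : set (L2 leb * L2 leb) :=
  [set uv : L2 leb * L2 leb | exists phi : Rn -> C,
    [/\ test_function phi,
        {ae leb, forall x, uv.1 x = phi x} &
        {ae leb, forall x, uv.2 x = - laplacian phi x + V x * phi x}]].

(* The graph of the closure is the closure of the graph; the product topology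
   on L2 * L2 is the norm topology. *)
Definition schrodinger (V : Rn -> C) : set (L2 leb * L2 leb) :=
  closure (schrodinger_core V).

End schrodinger.

(* Main.v *)
(** An element of the resolvent set has a neighbourhood on which the resolvent
    is uniformly bounded, so by compactness it suffices to bound [u] by
    [(H - z) u], uniformly in [z] and for test functions [u], when [Re z <= -1]
    and when [Re z <= r] and [|Im z|] is large.  The energy identity
    [|grad u|^2 + Re (V - z) |u|^2 = Re ((H - z) u * conj u) + divergence]
    settles the first region and, in the second one, bounds [|grad u|^2] and
    [|x|^2 |u|^2] in [L^1]; hence [u] has little mass far away.  Near the
    origin, multiply [(H - z) u] by [eta * conj u] for a compactly supported
    cutoff [eta] and take imaginary parts: [|Im z| eta |u|^2] is controlled by
    [|u|^2 + |grad u|^2] because [V] is bounded on the support of [eta], so for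
    [|Im z|] large the local mass is small too. *)
Require Import Defs.
From mathcomp Require Import all_boot all_order all_algebra.
From mathcomp Require Import complex.
From mathcomp Require Import all_classical all_reals all_analysis.
From mathcomp Require Import ring lra measurable_realfun.

Set Implicit Arguments.
Unset Strict Implicit.
Unset Printing Implicit Defensive.

Import Order.TTheory GRing.Theory Num.Theory.
Import numFieldNormedType.Exports.
Import ComplexField.Normc.

Local Open Scope classical_set_scope.
Local Open Scope ring_scope.

(** * Measurability and integrability on [R^n] *)

Section borel_rV.
Context (R : realType) (n : nat).
Local Notation leb := (lebesgue_rV R n).

(** Supports are located in sup-norm cubes: their volume is a product of side lengths, they are
    compact, and dropping the first coordinate leaves a cube. *)
Definition cube (r : R) : set 'rV[R]_n := [set x | forall i, `|x 0 i| <= r].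

Lemma measurable_bigcap_coord (A : 'I_n -> set (measurableTypeR R)) :
  (forall i, measurable (A i)) ->
  measurable [set x : 'rV[R]_n | forall i, A i (x 0 i)].
Proof.
move=> mA; rewrite (_ : mkset _ = \bigcap_(i in [set: 'I_n])
    ((fun x : 'rV[R]_n => x 0 i : measurableTypeR R) @^-1` A i)).
  apply: fin_bigcap_measurable => // i _.
  by rewrite -[X in measurable X]setTI; apply: measurable_rV_coord.
by apply/seteqP; split => x /= h i; [move=> _|]; have := h i => //; exact.
Qed.

Lemma cubeE (r : R) :
  cube r = [set x | forall i, x 0 i \in `[- r, r]].
Proof.
by apply/seteqP; split => x h i; have := h i; rewrite /= in_itv /= ler_norml.
Qed.

Lemma measurable_cube r : measurable (cube r).
Proof.
rewrite cubeE; apply: (@measurable_bigcap_coord (fun=> `[- r, r]%classic)) => i.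
exact: measurable_itv.
Qed.

Lemma lebesgue_rV_cube_lty r : 0 <= r -> (leb (cube r) < +oo)%E.
Proof. by move=> r0; rewrite cubeE lebesgue_rV_box ?ltry// => i; rewrite ge0_cp. Qed.

Lemma compact_cube r : compact (cube r).
Proof.
rewrite cubeE; apply: (@rV_compact _ _ (fun=> `[- r, r]%classic)) => i.
exact: segment_compact.
Qed.

Lemma measurable_ball_rV (x : 'rV[R]_n) e : measurable (ball x e).
Proof.
have [e0|e0] := ltP 0 e; last first.
  rewrite (_ : ball x e = set0)//; apply/seteqP; split => // y [].
  by rewrite ltNge e0.
rewrite (_ : ball x e = [set y | forall i, (ball (x 0 i) e) (y 0 i)]).
  apply: (@measurable_bigcap_coord (fun i => ball (x 0 i) e)) => i.
  exact: measurable_ball.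
apply/seteqP; split => y; first by case=> _ h i; exact: h.
by move=> h; split => // i j; rewrite ord1.
Qed.

(** The sigma-algebra is generated by the coordinates, so sup-norm balls are measurable as products
    of intervals. An open set is the union of the countably many balls with rational centre and
    radius [1/(k+1)] that it contains. *)
Lemma open_measurable_rV (U : set 'rV[R]_n) : open U -> measurable U.
Proof.
move=> oU; pose q (p : 'rV[rat]_n * nat) : set 'rV[R]_n :=
  ball (map_mx ratr p.1 : 'rV[R]_n) (p.2.+1%:R^-1).
pose F p := if `[< q p `<=` U >] then q p else set0.
suff -> : U = \bigcup_p F p.
  apply: countable_bigcupT_measurable => [|p]; first exact: countableP.
  by rewrite /F; case: asboolP => // _; exact: measurable_ball_rV.
apply/seteqP; split => [x Ux|x [p _]]; last first.
  by rewrite /F; case: asboolP => // h; exact: h.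
have /nbhs_ballP[e /= e0 eU] := open_nbhs_nbhs (conj oU Ux).
(* With twice the radius below [e], a ball of this radius that contains [x] lies inside
   [ball x e]. *)
pose k := Num.truncn (2 / e).
have ke : k.+1%:R^-1 + k.+1%:R^-1 < e.
  rewrite -mulr2n -[_ *+ 2]mulr_natl ltr_pdivrMr// mulrC -ltr_pdivrMr//.
  exact: truncnS_gt.
have k0 : 0 < k.+1%:R^-1 :> R by rewrite invr_gt0.
have /choice[y yx] : forall i : 'I_n, exists y : rat, `|ratr y - x 0 i| < k.+1%:R^-1.
  move=> i; have /rat_in_itvoo[y] : x 0 i - k.+1%:R^-1 < x 0 i + k.+1%:R^-1.
    by rewrite ltrD2l gtrN.
  by rewrite in_itv /= -ltr_distl distrC => h; exists y; rewrite distrC.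
have qx : ball (map_mx ratr (\row_i y i) : 'rV[R]_n) k.+1%:R^-1 x.
  by split => // i j; rewrite !mxE ord1 /ball /=; exact: yx.
exists (\row_i y i, k) => //; rewrite /F; case: asboolP => // [[]].
move=> z qz; apply: eU; apply: le_ball (ltW ke) _ _.
by apply: ball_triangle qz; exact: ball_sym.
Qed.

Lemma continuous_measurable_rV (f : 'rV[R]_n -> R) :
  continuous f -> measurable_fun setT (f : _ -> measurableTypeR R).
Proof.
move=> /continuousP cf; apply: (measurability _ (RGenOpens.measurableE R)).
move=> _ [_ [a [b ->] <-]]; rewrite setTI; apply: open_measurable_rV.
exact/cf/interval_open.
Qed.

Lemma continuous_cube_integrable (f : 'rV[R]_n -> R) r : 0 <= r ->
  continuous f -> (forall x, f x != 0 -> cube r x) ->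
  leb.-integrable setT (EFin \o f).
Proof.
move=> r0 cf fr.
have /compact_bounded[M [_ Mf]] : compact (f @` cube r).
  by apply: continuous_compact; [exact: continuous_subspaceT|exact: compact_cube].
apply: (@le_integrable _ _ _ _ _ _ _
    (fun x => (`|M| + 1)%:E * (\1_(cube r) x)%:E)%E) => //.
- apply/measurable_EFinP; exact: continuous_measurable_rV.
- move=> x _ /=; rewrite indicE lee_fin.
  have [fx0|/fr xr] := eqVneq (f x) 0; first by rewrite fx0 normr0.
  rewrite mem_set// mulr1 [leRHS]ger0_norm ?addr_ge0//.
  by apply: Mf; [rewrite (le_lt_trans (ler_norm _))// ltrDl|exists x].
- have mC : measurable (cube r) by exact: measurable_cube.
  apply: integrableZl => //; apply/integrableP; split.
    exact/measurable_EFinP.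
  rewrite (eq_integral (fun x => (\1_(cube r) x)%:E)); last first.
    by move=> t _; rewrite gee0_abs// lee_fin.
  by rewrite integral_indic// setIT lebesgue_rV_cube_lty.
Qed.

End borel_rV.

(** * The divergence theorem for compactly supported fields *)

Section derive_along_line.
Context (R : numFieldType) (U V W : normedModType R).
Variables (f : U -> W) (g : V -> W) (x v : U) (y w : V).
Hypothesis fg : forall h : R, f (h *: v + x) = g (h *: w + y).

(** A directional derivative only sees the restriction to a line. This identity transports
    derivatives from [R^(n+1)] to its slices. *)
Let fg_quot : (fun h => h^-1 *: ((f \o shift x) (h *: v) - f x)) =
              (fun h => h^-1 *: ((g \o shift y) (h *: w) - g y)).
Proof.
have fgxy : f x = g y by have := fg 0; rewrite !scale0r !add0r.
by apply/funext => h /=; rewrite fg fgxy.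
Qed.

Lemma eq_derivable_line : derivable f x v -> derivable g y w.
Proof. by rewrite /derivable fg_quot. Qed.

Lemma eq_derive_line : 'D_v f x = 'D_w g y.
Proof. by rewrite /derive fg_quot. Qed.

End derive_along_line.

Lemma integral_derive1_eq0 (R : realType) (f : R -> R) (r : R) : 0 <= r ->
  (forall x, derivable f x 1) -> continuous ('D_1 f) ->
  (forall x, f x != 0 -> `|x| <= r) ->
  (forall x, 'D_1 f x != 0 -> `|x| <= r) ->
  (\int[lebesgue_measure]_x ('D_1 f x)%:E = 0)%E.
Proof.
move=> r0 df cf fr f'r.
have f0 x : r < `|x| -> f x = 0.
  by move=> rx; apply/eqP/negPn/negP => /fr; rewrite leNgt rx.
have f'0 x : r < `|x| -> 'D_1 f x = 0.
  by move=> rx; apply/eqP/negPn/negP => /f'r; rewrite leNgt rx.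
have cf0 : continuous f.
  by move=> x; apply: differentiable_continuous; exact/derivable1_diffP.
(* The margin 1 puts the endpoints strictly outside the support, where [f] vanishes, and keeps the
   interval nondegenerate when [r = 0]. *)
transitivity (\int[lebesgue_measure]_(x in `[(- (r + 1))%R, (r + 1)%R]) ('D_1 f x)%:E)%E.
  rewrite [RHS]integral_mkcond; apply: eq_integral => x _.
  rewrite patchE; case: ifPn => // /negP xr; rewrite f'0//.
  rewrite ltNge; apply/negP => xr'; apply: xr.
  by rewrite inE /= in_itv /= -ler_norml (le_trans xr')// lerDl.
rewrite (@continuous_FTC2 _ _ f)//.
- rewrite !f0 ?subee// ?normrN ger0_norm ?ltrDl// addr_ge0//.
- by rewrite gtrN// ltr_wpDl.
- exact: continuous_subspaceT.
- split => //.
  + by apply: cvg_at_right_filter; exact: cf0.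
  + by apply: cvg_at_left_filter; exact: cf0.
- by move=> x _; rewrite derive1E.
Qed.

Section divergence.
Context (R : realType).
Local Notation leb := (lebesgue_rV R).

(** Outside the closed cube some coordinate exceeds [r] in absolute value, and still does nearby, so
    [f] vanishes on a neighbourhood. *)
Lemma derive_cube0 n (f : 'rV[R]_n -> R) (v x : 'rV[R]_n) r :
  (forall x, f x != 0 -> cube r x) -> 'D_v f x != 0 -> cube r x.
Proof.
move=> fr; apply: contraNP => xr; apply/eqP.
have /existsNP[i /negP] := xr; rewrite -ltNge => xi.
rewrite (@near_eq_derive _ _ _ f (cst 0)) ?derive_cst//.
have : \forall y \near x, r < `|(y : 'rV[R]_n) 0 i|.
  have cx : {for x, continuous (fun y : 'rV[R]_n => `|y 0 i|)}.
    apply: continuous_comp; last exact: norm_continuous.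
    exact: (@coord_continuous R 1 n 0 i x).
  exact: (cvgr_gt _ cx).
apply: filterS => y yr; apply/eqP/negPn/negP => /fr/(_ i).
by rewrite leNgt yr.
Qed.

Lemma rV_consD n (t : R) (y : 'rV[R]_n) s (v : 'rV[R]_n) :
  rV_cons (t, y) + rV_cons (s, v) = rV_cons (t + s, y + v).
Proof.
apply/rowP => k; rewrite mxE; case: (unliftP ord0 k) => [j|] ->.
  by rewrite !rV_consS mxE.
by rewrite !rV_cons0.
Qed.

Lemma rV_consZ n (h : R) (y : 'rV[R]_n) s :
  h *: rV_cons (s, y) = rV_cons (h * s, h *: y).
Proof.
apply/rowP => k; rewrite mxE; case: (unliftP ord0 k) => [j|] ->.
  by rewrite !rV_consS mxE.
by rewrite !rV_cons0.
Qed.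

Lemma delta_mx_cons n (j : 'I_n) :
  delta_mx 0 (lift ord0 j) = rV_cons (0 : R, delta_mx 0 j).
Proof.
apply/rowP => k; rewrite mxE /=; case: (unliftP ord0 k) => [l|] ->.
  by rewrite rV_consS mxE (inj_eq lift_inj).
by rewrite rV_cons0 (negbTE (neq_lift _ _)).
Qed.

Lemma delta_mx_cons0 n : delta_mx 0 ord0 = rV_cons (1 : R, 0 : 'rV[R]_n).
Proof.
apply/rowP => k; rewrite mxE /=; case: (unliftP ord0 k) => [l|] ->.
  by rewrite rV_consS mxE eq_sym (negbTE (neq_lift _ _)).
by rewrite rV_cons0.
Qed.

Lemma ball_rV_cons n (s t e : R) (y z : 'rV[R]_n) :
  `|s - t| < e -> ball y e z -> ball (rV_cons (s, y)) e (rV_cons (t, z)).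
Proof.
move=> st [e0 yz]; split => // i j; rewrite ord1.
case: (unliftP ord0 j) => [l|] ->; first by rewrite !rV_consS; exact: yz.
by rewrite !rV_cons0.
Qed.

Lemma continuous_rV_consl n (y : 'rV[R]_n) :
  continuous (fun t : R => rV_cons (t, y)).
Proof.
move=> t A /nbhs_ballP[e /= e0 eA]; apply/nbhs_ballP.
exists e => // s ts; apply: eA.
by apply: ball_rV_cons => //; exact: ballxx.
Qed.

Lemma continuous_rV_consr n (t : R) :
  continuous (fun y : 'rV[R]_n => rV_cons (t, y)).
Proof.
move=> y A /nbhs_ballP[e /= e0 eA]; apply/nbhs_ballP.
exists e => // z yz; apply: eA.
by apply: ball_rV_cons => //; rewrite subrr normr0.
Qed.

(** Induction on the dimension by Fubini, since [lebesgue_rV] in dimension [n.+1] is the image of a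
    product measure under [rV_cons]. *)
Lemma integral_pderiv_eq0 n (i : 'I_n) (f : 'rV[R]_n -> R) (r : R) : 0 <= r ->
  (forall x, derivable f x (delta_mx 0 i)) -> continuous (pderiv i f) ->
  (forall x, f x != 0 -> cube r x) ->
  (\int[leb n]_x (pderiv i f x)%:E = 0)%E.
Proof.
move=> r0; elim: n i f => [[]//|n IH] i f df cf fr.
have f'r x : pderiv i f x != 0 -> cube r x by exact: derive_cube0.
set g := pderiv i f.
have ig : (leb n.+1).-integrable setT (EFin \o g).
  exact: (continuous_cube_integrable r0).
have mg : measurable_fun setT (EFin \o g).
  by apply/measurable_EFinP; exact: continuous_measurable_rV.
have igc : (lebesgue_measure \x leb n)%E.-integrable setT
    ((EFin \o g) \o @rV_cons R n).
  apply/integrableP; split. exact: measurableT_comp mg (@measurable_rV_cons R n).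
  move/integrableP : ig => [_]; apply: le_lt_trans. 
  rewrite -[leRHS]/(\int[pushforward (lebesgue_measure \x leb n)%E (@rV_cons R n)]_x
    `|(EFin \o g) x|)%E.
  rewrite ge0_integral_pushforward//; first exact: measurable_rV_cons.
  by apply: measurableT_comp.
rewrite -[LHS]/(\int[pushforward (lebesgue_measure \x leb n)%E (@rV_cons R n)]_x
   (EFin \o g) x)%E.
rewrite (integral_pushforward (@measurable_rV_cons R n))// preimage_setT.
(* A derivative in a tail direction is integrated over the tail first, by induction; the derivative
   in the first direction is integrated over the first variable, by the one-dimensional case. *)
case: (unliftP ord0 i) => [j|] ij.
  rewrite -integral12_prod_meas1//; apply: integral0_eq => t _.
  have consj h y : rV_cons (t, h *: delta_mx 0 j + y) =
      h *: delta_mx 0 i + rV_cons (t, y).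
    by rewrite ij delta_mx_cons rV_consZ rV_consD mulr0 add0r.
  pose ft (y : 'rV[R]_n) := f (rV_cons (t, y)).
  have fte y h : f (h *: delta_mx 0 i + rV_cons (t, y)) =
      ft (h *: delta_mx 0 j + y) by rewrite /ft consj.
  have gt y : g (rV_cons (t, y)) = pderiv j ft y by exact: eq_derive_line.
  rewrite /fubini_F /=; under eq_integral do rewrite gt.
  apply: IH.
  - by move=> y; exact: eq_derivable_line (fte y) (df _).
  - rewrite (_ : pderiv j ft = g \o (fun y => rV_cons (t, y))); last first.
      by apply/funext => y /=; rewrite gt.
    move=> y; apply: (@continuous_comp _ _ _ _ g); last exact: cf.
    exact: continuous_rV_consr.
  - by move=> y /fr yr k; have := yr (lift ord0 k); rewrite rV_consS.
rewrite -integral21_prod_meas1//; apply: integral0_eq => y _.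
have consi h t : rV_cons (h + t, y) = h *: delta_mx 0 i + rV_cons (t, y).
  by rewrite ij delta_mx_cons0 rV_consZ rV_consD mulr1 scaler0 add0r.
pose fy (t : R) := f (rV_cons (t, y)).
have fye t h : f (h *: delta_mx 0 i + rV_cons (t, y)) = fy (h *: 1 + t).
  by rewrite /fy -consi [h *: 1]mulr1.
have gt t : g (rV_cons (t, y)) = 'D_1 fy t by exact: eq_derive_line.
rewrite /fubini_G /=; under eq_integral do rewrite gt.
apply: (@integral_derive1_eq0 _ fy r r0).
- by move=> t; exact: eq_derivable_line (fye t) (df _).
- rewrite (_ : 'D_1 fy = g \o (fun t => rV_cons (t, y))); last first.
    by apply/funext => t /=; rewrite gt.
  move=> t; apply: (@continuous_comp _ _ _ _ g); last exact: cf.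
  exact: continuous_rV_consl.
- by move=> t /fr /(_ ord0); rewrite rV_cons0.
- by move=> t; rewrite -gt => /f'r /(_ ord0); rewrite rV_cons0.
Qed.

Lemma integral_div_eq0 n (f : 'I_n -> 'rV[R]_n -> R) (r : R) : 0 <= r ->
  (forall i x, derivable (f i) x (delta_mx 0 i)) ->
  (forall i, continuous (pderiv i (f i))) ->
  (forall i x, f i x != 0 -> cube r x) ->
  (leb n).-integrable setT (fun x => (\sum_i pderiv i (f i) x)%:E) /\
  (\int[leb n]_x (\sum_i pderiv i (f i) x)%:E = 0)%E.
Proof.
move=> r0 df cf fr.
have ig i : (leb n).-integrable setT (EFin \o pderiv i (f i)).
  apply: (continuous_cube_integrable r0 (cf i)) => x.
  by apply: derive_cube0 => y; exact: fr.
have -> : (fun x => (\sum_i pderiv i (f i) x)%:E) =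
    (fun x => \sum_i (pderiv i (f i) x)%:E)%E.
  by apply/funext => x; rewrite sumEFin.
split; first by apply: integrable_sum => // i _; exact: ig.
rewrite (@integral_sum _ _ R (leb n))//; apply: big1 => i _.
exact: (integral_pderiv_eq0 r0 (df i) (cf i) (fr i)).
Qed.

End divergence.

(** * The cutoff *)

(** The difference quotient is within [C * |h|] of [l]. The criterion is meant for the cutoff, whose
    base has a kink that the chain rule cannot cross. *)
Lemma is_derive_quadratic_remainder (R : realType) (V : normedModType R)
    (f : V -> R) (x v : V) (l C : R) :
  (forall h : R, `|h| <= 1 -> `|f (h *: v + x) - f x - h * l| <= C * h ^+ 2) ->
  is_derive x v f l.
Proof.
move=> fC.
have fl : (h^-1 *: ((f \o shift x) (h *: v) - f x)) @[h --> 0^'] --> l.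
  apply/cvgrPdist_le => e e0; near=> h.
  have h0 : h != 0 by near: h; exact: nbhs_dnbhs_neq.
  have h1 : `|h| <= 1 by near: h; exact: dnbhs0_le.
  have he : `|h| * (`|C| + 1) <= e.
    rewrite -ler_pdivlMr ?ltr_wpDl//; near: h; apply: dnbhs0_le.
    by rewrite divr_gt0// ltr_wpDl.
  rewrite distrC /= /GRing.scale /=.
  have -> : h^-1 * (f (h *: v + x) - f x) - l =
      h^-1 * (f (h *: v + x) - f x - h * l) by field.
  rewrite normrM normfV ler_pdivrMl ?normr_gt0//.
  rewrite (le_trans (fC h h1))// -[h ^+ 2]real_normK ?num_real// expr2.
  rewrite (le_trans (ler_wpM2r _ (ler_norm C))) ?mulr_ge0//.
  by rewrite mulrCA ler_wpM2l// (le_trans _ he)// mulrC ler_wpM2l// lerDl.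
by apply: DeriveDef; [apply/cvg_ex; exists l|exact: cvg_lim].
Unshelve. all: by end_near. Qed.

Section continuous_ring_ops.
Context (R : realType) (T : topologicalType).
Implicit Types f g : T -> R.

Lemma fct_continuousD f g :
  continuous f -> continuous g -> continuous (fun x => f x + g x).
Proof. by move=> cf cg x; exact: (cvgD (cf x) (cg x)). Qed.

Lemma fct_continuousB f g :
  continuous f -> continuous g -> continuous (fun x => f x - g x).
Proof. by move=> cf cg x; exact: (cvgB (cf x) (cg x)). Qed.

Lemma fct_continuousN f : continuous f -> continuous (fun x => - f x).
Proof. by move=> cf x; exact: (cvgN (cf x)). Qed.

Lemma fct_continuousM f g :
  continuous f -> continuous g -> continuous (fun x => f x * g x).
Proof. by move=> cf cg x; exact: (cvgM (cf x) (cg x)). Qed.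

Lemma fct_continuous_sqr f : continuous f -> continuous (fun x => f x ^+ 2).
Proof. by move=> cf; exact: fct_continuousM. Qed.

Lemma fct_continuous_cst (a : R) : continuous (fun _ : T => a).
Proof. by move=> x; exact: cvg_cst. Qed.

End continuous_ring_ops.

Section cutoff.
Context (R : realType) (n : nat).
Implicit Types (x : 'rV[R]_n) (t : R).

Definition sqnorm x : R := \sum_i x 0 i ^+ 2.

Lemma sqnorm_ge0 x : 0 <= sqnorm x.
Proof. by apply: sumr_ge0 => i _; exact: sqr_ge0. Qed.

Lemma coord_le_sqnorm x i : x 0 i ^+ 2 <= sqnorm x.
Proof. by rewrite /sqnorm (bigD1 i)//= lerDl sumr_ge0// => j _; exact: sqr_ge0. Qed.

Lemma sqnorm_delta x i h :
  sqnorm (h *: delta_mx 0 i + x) = sqnorm x + (2 * h * x 0 i + h ^+ 2).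
Proof.
rewrite /sqnorm (bigD1 i)//= [in RHS](bigD1 i)//= !mxE !eqxx/=.
rewrite (eq_bigr (fun j => x 0 j ^+ 2)); last first.
  by move=> j /negPf ji; rewrite !mxE eqxx ji mulr0 add0r.
by rewrite mulr1; ring.
Qed.

Lemma continuous_sqnorm : continuous sqnorm.
Proof.
apply: continuous_big => [|i _]; first exact: add_continuous.
by apply: fct_continuous_sqr; exact: coord_continuous.
Qed.

(** The cutoff eta is the square of the positive part of [1 - |x|^2 / t]. Squaring makes it
    continuously differentiable across the sphere [|x|^2 = t], which is all the divergence theorem
    asks of it. *)
Definition cutoff_base t x := Num.max 0 (1 - sqnorm x / t).

Definition cutoff t x := cutoff_base t x ^+ 2.

Definition dcutoff t i x := 2 * cutoff_base t x * (- (2 * x 0 i) / t).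

Variable t : R.
Hypothesis t0 : 0 < t.

Lemma cutoff_base_ge0 x : 0 <= cutoff_base t x.
Proof. by rewrite /cutoff_base le_max lexx. Qed.

Lemma cutoff_base_le1 x : cutoff_base t x <= 1.
Proof. by rewrite /cutoff_base ge_max ler01 gerBl divr_ge0 ?sqnorm_ge0 ?ltW. Qed.

Lemma cutoff_base_gt0 x : cutoff_base t x != 0 -> sqnorm x <= t.
Proof.
rewrite /cutoff_base; apply: contraNT; rewrite -ltNge => tx.
by rewrite max_l// subr_le0 ler_pdivlMr// mul1r ltW.
Qed.

Lemma cutoff_ge0 x : 0 <= cutoff t x.
Proof. exact: sqr_ge0. Qed.

Lemma cutoff_le1 x : cutoff t x <= 1.
Proof. by rewrite /cutoff expr_le1 ?cutoff_base_ge0 ?cutoff_base_le1. Qed.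

(** The support lies in [|x|^2 <= t], and [t + 1] bounds the square root of [t]. *)
Lemma cutoff_support x : cutoff t x != 0 -> cube (t + 1) x.
Proof.
rewrite /cutoff expf_eq0/= => /cutoff_base_gt0 xt i.
rewrite -ler_sqr ?nnegrE ?addr_ge0 ?(ltW t0)// real_normK ?num_real//.
by rewrite (le_trans (coord_le_sqnorm x i))// (le_trans xt)//; nra.
Qed.

Lemma cutoff_ge_half x : sqnorm x <= t / 4 -> 2^-1 <= cutoff t x.
Proof.
move=> xt; have h : 3 / 4 <= cutoff_base t x.
  rewrite /cutoff_base le_max; apply/orP; right.
  have : sqnorm x / t <= 1 / 4 by rewrite ler_pdivrMr//; lra.
  by lra.
rewrite /cutoff; nra.
Qed.

(** The square of the positive part has remainder at most [e^2] for an increment [e] of its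
    argument; the second-order part of [e] itself, [h^2 / t], accounts for the constant [2 / t]. *)
Lemma is_derive_cutoff i x :
  is_derive x (delta_mx 0 i) (cutoff t) (dcutoff t i x).
Proof.
(* This is the Lipschitz constant giving [|e| <= k * |h|] for [|h| <= 1]. *)
pose k := (2 * `|x 0 i| + 1) / t.
apply: (@is_derive_quadratic_remainder _ _ _ _ _ _ (2 / t + k ^+ 2)) => h h1.
pose e := - (2 * h * x 0 i + h ^+ 2) / t.
have -> : cutoff t (h *: delta_mx 0 i + x) =
    Num.max 0 (1 - sqnorm x / t + e) ^+ 2.
  rewrite /cutoff /cutoff_base sqnorm_delta /e; congr (Num.max _ _ ^+ 2).
  by field; rewrite gt_eqF.
have ek : e ^+ 2 <= k ^+ 2 * h ^+ 2.
  rewrite -exprMn -[e ^+ 2]real_normK ?num_real//.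
  rewrite -[leRHS]real_normK ?num_real// ler_pXn2r ?nnegrE//.
  have k0 : 0 <= k by rewrite divr_ge0 ?addr_ge0 ?mulr_ge0// ltW.
  rewrite /e normrM normrN [leRHS]normrM (ger0_norm k0).
  rewrite normfV (gtr0_norm t0) /k.
  rewrite [leRHS](_ : _ = (2 * `|x 0 i| + 1) * `|h| * t^-1); last by ring.
  rewrite ler_pM2r ?invr_gt0//.
  rewrite (le_trans (ler_normD _ _))// normrX !normrM gtr0_norm//.
  have := normr_ge0 h; nra.
have -> : dcutoff t i x = 2 * cutoff_base t x * (- (2 * x 0 i) / t) by [].
have he : h * (2 * cutoff_base t x * (- (2 * x 0 i) / t)) =
    2 * cutoff_base t x * e + 2 * cutoff_base t x * h ^+ 2 / t.
  by rewrite /e; field; rewrite gt_eqF.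
rewrite he /cutoff.
have a0 := cutoff_base_ge0 x; have a1 := cutoff_base_le1 x.
have hh : cutoff_base t x * h ^+ 2 / t <= h ^+ 2 / t.
  rewrite -mulrA ler_piMl ?cutoff_base_le1// divr_ge0 ?sqr_ge0 ?(ltW t0)//.
have hh0 : 0 <= cutoff_base t x * h ^+ 2 / t.
  apply: divr_ge0; last exact: ltW.
  by apply: mulr_ge0; [exact: cutoff_base_ge0|exact: sqr_ge0].
rewrite [leRHS]mulrDl (_ : 2 / t * h ^+ 2 = 2 * (h ^+ 2 / t)); last by ring.
move: a0 a1 hh hh0 ek; rewrite /cutoff_base.
set w := 1 - _; set H := h ^+ 2 / t; rewrite -/H.
have -> : 2 * Num.max 0 w * h ^+ 2 / t = 2 * (Num.max 0 w * h ^+ 2 / t) by ring.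
set G := _ * h ^+ 2 / t; set K := k ^+ 2 * _ => + + hh hh0 ek.
clearbody w e G H K.
case: (leP 0 w) => w0; case: (leP 0 (w + e)) => we a0 a1;
  by rewrite ler_norml; apply/andP; split; nra.
Qed.

(** The sum is [16 * cutoff_base^2 * |x|^2 / t^2], and [|x|^2 <= t] wherever the base is nonzero. *)
Lemma sum_dcutoff_sqr x : \sum_i dcutoff t i x ^+ 2 <= 16 / t.
Proof.
have -> : \sum_i dcutoff t i x ^+ 2 =
    16 * cutoff_base t x ^+ 2 / t ^+ 2 * sqnorm x.
  rewrite /sqnorm mulr_sumr; apply: eq_bigr => i _; rewrite /dcutoff.
  by field; rewrite gt_eqF.
have [->|/cutoff_base_gt0 xt] := eqVneq (cutoff_base t x) 0.
  by rewrite expr0n /= mulr0 !mul0r divr_ge0// ltW.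
rewrite mulrAC ler_pdivrMr ?exprn_gt0// (_ : 16 / t * t ^+ 2 = 16 * t); last first.
  by field; rewrite gt_eqF.
rewrite -mulrA ler_pM2l// -[leRHS]mul1r ler_pM ?sqr_ge0 ?sqnorm_ge0//.
exact: cutoff_le1.
Qed.

Lemma continuous_cutoff_base : continuous (cutoff_base t).
Proof.
have cs : continuous (fun x => 1 - sqnorm x / t).
  apply: fct_continuousB; first exact: fct_continuous_cst.
  apply: fct_continuousM; last exact: fct_continuous_cst.
  exact: continuous_sqnorm.
move=> x; apply: (@continuous_max _ _ (fun=> 0) (fun x => 1 - sqnorm x / t)).
  exact: fct_continuous_cst.
exact: cs.
Qed.

Lemma continuous_cutoff : continuous (cutoff t).
Proof. by apply: fct_continuous_sqr; exact: continuous_cutoff_base. Qed.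

Lemma continuous_dcutoff i : continuous (dcutoff t i).
Proof.
apply: fct_continuousM.
  apply: fct_continuousM; last exact: continuous_cutoff_base.
  exact: fct_continuous_cst.
apply: fct_continuousM; last exact: fct_continuous_cst.
apply: fct_continuousN.
apply: fct_continuousM; last exact: coord_continuous.
exact: fct_continuous_cst.
Qed.

End cutoff.

(** * Pointwise inequalities *)

Section pointwise_inequalities.
Context (R : realFieldType).
Variables (p q lp lq v1 v2 x s : R).

(** Read [u = p + i q], [lp + i lq] for the Laplacian of [u], [v1 + i v2 = V] and [x + i s = z];
    then [f1 + i f2] is [(H - z) u]. *)
Let m := p ^+ 2 + q ^+ 2.
Let f1 := - lp + (v1 * p - v2 * q) - (x * p - s * q).
Let f2 := - lq + (v1 * q + v2 * p) - (x * q + s * p).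
Let F := f1 ^+ 2 + f2 ^+ 2.

Let m0 : 0 <= m.
Proof. by rewrite addr_ge0 ?sqr_ge0. Qed.

(** This is the real part of [(H - z) u * conj u] with Young's inequality; the gap is half of
    [|(H - z) u - u|^2]. For [g = |grad u|^2] the last bracket is a divergence. *)
Lemma energy_ineq (g : R) :
  g + (v1 - x) * m <= F / 2 + m / 2 + (g + p * lp + q * lq).
Proof.
rewrite -subr_ge0 (_ : _ - _ = ((f1 - p) ^+ 2 + (f2 - q) ^+ 2) / 2).
  by rewrite divr_ge0 ?addr_ge0 ?sqr_ge0.
by rewrite /F /m /f1 /f2; field.
Qed.

(** This is the imaginary part of [(H - z) u * conj u], multiplied by [y = eta] and by the sign [sg]
    of [s]. With [eb] the contribution of the gradient of eta, the last bracket is a divergence. *)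
Lemma cutoff_ineq (sg y eb : R) : sg ^+ 2 = 1 -> 0 <= y <= 1 ->
  sg * s * (y * m) <= y * `|v2| * m + `|eb| + F / 2 + m / 2
    - sg * (eb + y * (p * lq - q * lp)).
Proof.
move=> sg2 /andP[y0 y1].
have -> : sg * s * (y * m) = sg * v2 * (y * m) + sg * eb
    - sg * y * (f2 * p - f1 * q) - sg * (eb + y * (p * lq - q * lp)).
  by rewrite /f1 /f2 /m; ring.
have sg1 : `|sg| = 1.
  have : `|sg| ^+ 2 = 1 by rewrite real_normK ?num_real.
  by move/eqP; rewrite sqrp_eq1// => /eqP.
rewrite lerD2r; have h1 : sg * v2 * (y * m) <= y * `|v2| * m.
  rewrite mulrA -[y * `|v2|]mulrC ler_wpM2r// ler_wpM2r//.
  by rewrite (le_trans (ler_norm _))// normrM sg1 mul1r.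
have h2 : sg * eb <= `|eb|.
  by rewrite (le_trans (ler_norm _))// normrM sg1 mul1r.
have h3 : - (sg * (f2 * p - f1 * q)) <= F / 2 + m / 2.
  rewrite (_ : F / 2 + m / 2 = - (sg * (f2 * p - f1 * q)) +
      ((f2 * sg + p) ^+ 2 + (f1 * sg - q) ^+ 2) / 2).
    by rewrite lerDl divr_ge0 ?addr_ge0 ?sqr_ge0.
  by rewrite !(sqrrD, sqrrB) !exprMn sg2 /F /m; field.
have h4 : 0 <= F / 2 + m / 2.
  by rewrite addr_ge0// divr_ge0// addr_ge0 ?sqr_ge0.
have h5 : - (sg * y * (f2 * p - f1 * q)) <= F / 2 + m / 2.
  have -> : - (sg * y * (f2 * p - f1 * q)) = y * - (sg * (f2 * p - f1 * q)) by ring.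
  apply: (le_trans (ler_wpM2l y0 h3)); exact: ler_piMl.
lra.
Qed.

End pointwise_inequalities.

(* Here [m = |u|^2], [g = |grad u|^2], [F = |(H - z) u|^2], [N2 = |x|^2],
   [y = eta], [v1 + i v2 = V], [x = Re z], [sgs = |Im z|], and [dA], [dB] are
   divergences, which disappear upon integration. *)
Lemma absorption (R : realFieldType)
    (m F dA dB v1 v2 x sgs g eb y N2 a b c d r t M E K : R)
    (m0 : 0 <= m) (F0 : 0 <= F) (g0 : 0 <= g)
    (energy : g + (v1 - x) * m <= F / 2 + m / 2 + dA)
    (local : sgs * (y * m) <= y * `|v2| * m + `|eb| + F / 2 + m / 2 - dB)
    (ebE : `|eb| <= (E * m + g) / 2)
    (y0 : 0 <= y) (yv2 : y * `|v2| <= M)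
    (c0 : 0 < c) (t0 : 0 < t) (N0 : 0 <= N2)
    (y_large : N2 <= t / 4 -> 2^-1 <= y)
    (v1_ge : c * N2 - d <= v1) (xr : x <= r) (sgs0 : 0 < sgs)
    (bE : b = sgs^-1) (aE : a = 4 / (c * t)) (KE : K = r + d + 2^-1)
    (aK : a * K <= 8^-1) (bM : b * (2 * M + 1 + E + K) <= 4^-1) (b1 : b <= 1) :
  m / 2 <= (3 / 2 + a / 2) * F + ((b + a) * dA - 2 * b * dB).
Proof.
have b0 : 0 < b by rewrite bE invr_gt0.
have a0 : 0 < a by rewrite aE divr_gt0// mulr_gt0.
have Nm : 0 <= c * N2 * m by rewrite !mulr_ge0// ltW.
(* The growth of [Re V] turns the energy inequality into joint control of [|grad u|^2] and
   [c |x|^2 |u|^2]. *)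
have T : g + c * N2 * m <= K * m + F / 2 + dA.
  have : (c * N2 - d - r) * m <= (v1 - x) * m.
    by apply: ler_wpM2r => //; exact: lerB.
  by rewrite KE; lra.
(* The localized inequality is divided by [|Im z|], the gradient part of [eb] being kept as
   [g / 2]. *)
have ym : y * m <= b * ((M + 2^-1 + E / 2) * m + F / 2 + g / 2 - dB).
  rewrite bE [leRHS]mulrC ler_pdivlMr// mulrC.
  have : y * `|v2| * m <= M * m by rewrite ler_wpM2r.
  by lra.
(* Near the origin [y >= 1/2] and the first term suffices; far away [N2 > t / 4] and the second one
   does, as [a * c = 4 / t]. *)
have mym : m <= 2 * (y * m) + a * (c * N2 * m).
  have [/y_large yy|/ltW yy] := leP N2 (t / 4).
    have : 2^-1 * m <= y * m by rewrite ler_wpM2r.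
    have : 0 <= a * (c * N2 * m) by rewrite mulr_ge0// ltW.
    lra.
  have -> : a * (c * N2 * m) = 4 * N2 / t * m.
    by rewrite aE; field; rewrite !gt_eqF.
  have : 1 * m <= 4 * N2 / t * m by rewrite ler_wpM2r// ler_pdivlMr//; lra.
  have : 0 <= y * m by rewrite mulr_ge0.
  lra.
(* By [h1] to [h4] the mass on the right is at most [(1/4 + 1/8) * m], which leaves more than
   [m / 2] on the left. *)
have h1 : b * g <= b * (K * m + F / 2 + dA).
  by apply: ler_wpM2l; [exact: ltW|lra].
have h2 : a * (c * N2 * m) <= a * (K * m + F / 2 + dA).
  by apply: ler_wpM2l; [exact: ltW|lra].
have h3 : a * K * m <= 8^-1 * m by rewrite ler_wpM2r.
have h4 : b * (2 * M + 1 + E + K) * m <= 4^-1 * m by rewrite ler_wpM2r.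
have h5 : b * F <= 1 * F by rewrite ler_wpM2r.
lra.
Qed.

(** * From pointwise to [L^2] inequalities *)

(** As [g + D] is nonnegative only almost everywhere, its positive part takes its place, so that
    monotonicity for nonnegative functions applies without integrability of [f]. *)
Lemma ae_le_integral_divergence d (T : measurableType d) (R : realType)
    (mu : {measure set T -> \bar R}) (f g D : T -> R) :
  measurable_fun setT f -> (forall x, 0 <= f x) ->
  mu.-integrable setT (EFin \o g) -> mu.-integrable setT (EFin \o D) ->
  (\int[mu]_x (D x)%:E = 0)%E ->
  {ae mu, forall x, f x <= g x + D x} ->
  (\int[mu]_x (f x)%:E <= \int[mu]_x (g x)%:E)%E.
Proof.
move=> mf f0 ig iD D0 fgD.
have igD : mu.-integrable setT (EFin \o (fun x => g x + D x)).
  have := integrableD measurableT ig iD.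
  by apply: eq_integrable => // x _ /=; rewrite EFinD.
have mgD : measurable_fun setT (fun x => g x + D x).
  by apply/measurable_EFinP; exact: measurable_int igD.
have mM : measurable_fun setT (fun x => Num.max 0 (g x + D x)).
  exact: measurable_maxr.
have -> : (\int[mu]_x (g x)%:E = \int[mu]_x (Num.max 0 (g x + D x))%:E)%E.
  transitivity (\int[mu]_x (g x + D x)%:E)%E.
    under [RHS]eq_integral do rewrite EFinD.
    by rewrite integralD//= D0 adde0.
  apply: ae_eq_integral => //.
  - exact/measurable_EFinP.
  - exact/measurable_EFinP.
  - by apply: filterS fgD => x fx _; rewrite max_r// (le_trans (f0 x)).
apply: ae_ge0_le_integral => //.
- by move=> x _; rewrite lee_fin.
- exact/measurable_EFinP.
- by move=> x _; rewrite lee_fin le_max lexx.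
- exact/measurable_EFinP.
- by apply: filterS fgD => x fx _; rewrite lee_fin le_max fx orbT.
Qed.

Section L2norm_integral.
Context (R : realType) (d : measure_display) (T : measurableType d).
Variable mu : {measure set T -> \bar R}.
Implicit Types f : L2fun mu.

Lemma measurable_normc_sqr f : measurable_fun setT (fun x => normc (f x) ^+ 2).
Proof. by apply: measurable_funX; exact/cmeasurable_normc/L2fun_meas. Qed.

Lemma L2norm_sqr f : ((L2norm f) ^+ 2)%:E = (\int[mu]_x (normc (f x) ^+ 2)%:E)%E.
Proof.
have := @poweR_Lnorm _ _ _ mu (EFin \o (@normc R \o f)) 2%R.
rewrite pnatr_eq0 -L2normE => /(_ isT).
rewrite poweR_EFin powR_mulrn ?L2norm_ge0// => ->.
apply: eq_integral => x _.
by rewrite /= powR_mulrn// real_normK ?num_real.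
Qed.

Lemma integrable_normc_sqr f :
  mu.-integrable setT (fun x => (normc (f x) ^+ 2)%:E).
Proof.
apply/integrableP; split; first exact/measurable_EFinP/measurable_normc_sqr.
rewrite (eq_integral (fun x => (normc (f x) ^+ 2)%:E)); last first.
  by move=> x _; rewrite gee0_abs// lee_fin sqr_ge0.
by rewrite -L2norm_sqr ltry.
Qed.

Lemma L2norm_le_divergence (u w : L2fun mu) (D : T -> R) (C : R) :
  mu.-integrable setT (EFin \o D) -> (\int[mu]_x (D x)%:E = 0)%E ->
  {ae mu, forall x, normc (u x) ^+ 2 / 2 <= C * normc (w x) ^+ 2 + D x} ->
  L2norm u ^+ 2 / 2 <= C * L2norm w ^+ 2.
Proof.
move=> iD D0 uw.
have mu2 : measurable_fun setT (fun x => normc (u x) ^+ 2 / 2).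
  by apply: measurable_funM => //; exact: measurable_normc_sqr.
have iw : mu.-integrable setT (EFin \o (fun x => C * normc (w x) ^+ 2)).
  have := integrableZl measurableT C (integrable_normc_sqr w).
  by apply: eq_integrable.
have u0 x : 0 <= normc (u x) ^+ 2 / 2 by rewrite divr_ge0 ?sqr_ge0.
have intl := ae_le_integral_divergence mu2 u0 iw iD D0 uw.
rewrite -lee_fin [leLHS]EFinM [leRHS]EFinM !L2norm_sqr.
rewrite -integralZr//; last exact: integrable_normc_sqr.
by rewrite -integralZl//; last exact: integrable_normc_sqr.
Qed.

End L2norm_integral.

(** * Energy flux and localized flux of a test function *)

Section flux.
Context (R : realType) (n : nat).
Variables (t al be : R) (p q : 'rV[R]_n -> R).
Hypotheses (t0 : 0 < t) (p2 : Ck 2 p) (q2 : Ck 2 q).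

(* With [u = p + i q], the first summand is the flux [Re (conj u grad u)] of
   the energy identity and the second one [eta Im (conj u grad u)]. *)
Definition flux (i : 'I_n) (x : 'rV[R]_n) : R :=
  al * (p x * pderiv i p x + q x * pderiv i q x)
  - be * (cutoff t x * (p x * pderiv i q x - q x * pderiv i p x)).

Definition dflux (i : 'I_n) (x : 'rV[R]_n) : R :=
  al * (pderiv i p x ^+ 2 + p x * pderiv i (pderiv i p) x
        + (pderiv i q x ^+ 2 + q x * pderiv i (pderiv i q) x))
  - be * (dcutoff t i x * (p x * pderiv i q x - q x * pderiv i p x)
          + cutoff t x * (p x * pderiv i (pderiv i q) x
                          - q x * pderiv i (pderiv i p) x)).

(** In the second summand the products of first derivatives of [p] and [q] cancel. *)
Lemma is_derive_flux i x : is_derive x (delta_mx 0 i) (flux i) (dflux i x).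
Proof.
have [_ /(_ i)[pd [_ /(_ i)[ppd _]]]] := p2.
have [_ /(_ i)[qd [_ /(_ i)[qqd _]]]] := q2.
have dp := derivableP (pd x); have dq := derivableP (qd x).
have dP := derivableP (ppd x); have dQ := derivableP (qqd x).
have dE := is_derive_cutoff t0 i x.
have dA := is_deriveD (is_deriveM dp dP) (is_deriveM dq dQ).
have dB := is_deriveM dE (is_deriveB (is_deriveM dp dQ) (is_deriveM dq dP)).
have dF := is_deriveB (is_deriveZ al dA) (is_deriveZ be dB).
apply: (is_derive_eq dF).
rewrite /dflux /GRing.scale /= -/(pderiv i p x) -/(pderiv i q x).
rewrite -/(pderiv i (pderiv i p) x) -/(pderiv i (pderiv i q) x).
have -> : (p * pderiv i q - q * pderiv i p) x =
  p x * pderiv i q x - q x * pderiv i p x by [].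
move: (pderiv i (pderiv i p) x) (pderiv i (pderiv i q) x) => pp qq.
move: (pderiv i p x) (pderiv i q x) (p x) (q x) => P Q a b.
by move: (dcutoff t i x) (cutoff t x) => E y; ring.
Qed.

Lemma continuous_dflux i : continuous (dflux i).
Proof.
have [cp /(_ i)[_ [cP /(_ i)[_ [cpp _]]]]] := p2.
have [cq /(_ i)[_ [cQ /(_ i)[_ [cqq _]]]]] := q2.
have ce := @continuous_cutoff R n t; have cE := @continuous_dcutoff R n t i.
have cA := fct_continuousD
  (fct_continuousD (fct_continuous_sqr cP) (fct_continuousM cp cpp))
  (fct_continuousD (fct_continuous_sqr cQ) (fct_continuousM cq cqq)).
have cB := fct_continuousD
  (fct_continuousM cE (fct_continuousB (fct_continuousM cp cQ) (fct_continuousM cq cP)))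
  (fct_continuousM ce
    (fct_continuousB (fct_continuousM cp cqq) (fct_continuousM cq cpp))).
by apply: fct_continuousB; apply: fct_continuousM => //; exact: fct_continuous_cst.
Qed.

Lemma integral_dflux r : 0 <= r -> (forall x, ~ cube r x -> p x = 0 /\ q x = 0) ->
  (lebesgue_rV R n).-integrable setT (EFin \o (fun x => \sum_i dflux i x)) /\
  (\int[lebesgue_rV R n]_x (\sum_i dflux i x)%:E = 0)%E.
Proof.
move=> r0 pq0.
have fluxE i x : pderiv i (flux i) x = dflux i x.
  by have [_] := is_derive_flux i x.
have -> : (fun x => \sum_i dflux i x) = (fun x => \sum_i pderiv i (flux i) x).
  by apply/funext => x; apply: eq_bigr => i _; rewrite fluxE.
under eq_integral do under eq_bigr do rewrite -fluxE.
apply: (integral_div_eq0 r0).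
- by move=> i x; have [] := is_derive_flux i x.
- by move=> i; rewrite (funext (fluxE i)); exact: continuous_dflux.
- move=> i x; apply: contraNP => /pq0[px qx].
  by rewrite /flux px qx; apply/eqP; ring.
Qed.

(** The factors of [al] and [be] are the two divergences in [energy_ineq] and [cutoff_ineq]. *)
Lemma sum_dflux x : \sum_i dflux i x =
  al * (\sum_i (pderiv i p x ^+ 2 + pderiv i q x ^+ 2)
        + p x * \sum_i pderiv i (pderiv i p) x
        + q x * \sum_i pderiv i (pderiv i q) x)
  - be * (\sum_i dcutoff t i x * (p x * pderiv i q x - q x * pderiv i p x)
          + cutoff t x * (p x * \sum_i pderiv i (pderiv i q) x
                          - q x * \sum_i pderiv i (pderiv i p) x)).
Proof.
rewrite sumrB -!mulr_sumr; congr (al * _ - be * _).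
  rewrite !mulr_sumr -!big_split/=; apply: eq_bigr => i _.
  move: (pderiv i (pderiv i p) x) (pderiv i (pderiv i q) x) => pp qq.
  by move: (pderiv i p x) (pderiv i q x) (p x) (q x) => P Q a b; ring.
by rewrite !mulr_sumr -sumrB mulr_sumr -big_split.
Qed.

(** Young's inequality in each coordinate, the squares [h1] and [h2] serving the two signs, followed
    by [sum_dcutoff_sqr]. *)
Lemma cutoff_flux_le x :
  `|\sum_i dcutoff t i x * (p x * pderiv i q x - q x * pderiv i p x)| <=
  (16 / t * (p x ^+ 2 + q x ^+ 2)
   + \sum_i (pderiv i p x ^+ 2 + pderiv i q x ^+ 2)) / 2.
Proof.
apply: (le_trans (ler_norm_sum _ _ _)).
apply: (@le_trans _ _ (\sum_i (dcutoff t i x ^+ 2 * (p x ^+ 2 + q x ^+ 2)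
   + (pderiv i p x ^+ 2 + pderiv i q x ^+ 2)) / 2)).
  apply: ler_sum => i _.
  set e := dcutoff t i x; set P := pderiv i p x; set Q := pderiv i q x.
  have h1 : 0 <= (e * p x - Q) ^+ 2 + (e * q x + P) ^+ 2.
    by rewrite addr_ge0 ?sqr_ge0.
  have h2 : 0 <= (e * p x + Q) ^+ 2 + (e * q x - P) ^+ 2.
    by rewrite addr_ge0 ?sqr_ge0.
  by rewrite ler_norml; apply/andP; split; lra.
rewrite -mulr_suml big_split/= -mulr_suml ler_pM2r// lerD2r.
by rewrite ler_wpM2r ?addr_ge0 ?sqr_ge0// sum_dcutoff_sqr.
Qed.

End flux.

Lemma test_function_cube (R : realType) (n : nat) (phi : 'rV[R]_n -> R[i]) :
  test_function phi -> exists2 r, 0 <= r & forall x, phi x != 0 -> cube r x.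
Proof.
move=> [_ _ /compact_bounded[M [_ Mphi]]].
exists (`|M| + 1) => [|x phix i]; first by rewrite addr_ge0.
have := Mphi (`|M| + 1); rewrite (le_lt_trans (ler_norm M)) ?ltrDl// => /(_ isT x).
move=> /(_ (@subset_closure _ [set y | phi y != 0] x phix)); apply: le_trans.
by rewrite [leRHS]/Num.norm /= mx_normrE; apply/bigmax_geP; right; exists (0, i).
Qed.

(** * Lower bounds for [A - z] *)

Section real_norm.
Local Open Scope complex_scope.

Lemma normc_le_norm (R : realType) (a b : R) : normc (a +i* b) <= `|a| + `|b|.
Proof.
rewrite -[leRHS]ger0_norm ?addr_ge0// -sqrtr_sqr /= ler_wsqrtr//.
rewrite sqrrD !real_normK ?num_real// addrAC lerDl.
by rewrite mulrn_wge0// mulr_ge0.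
Qed.

Context (R : realType) (E : normedModType R[i]).
Implicit Types (u v : E) (z : R[i]) (A : set (E * E)).

Definition rnorm u : R := complex.Re `|u|.

Lemma rnormE u : `|u| = (rnorm u)%:C.
Proof.
by rewrite /rnorm; have := normr_ge0 u; case: `|u| => a b /andP[/eqP/= -> _].
Qed.

Lemma rnorm_ge0 u : 0 <= rnorm u.
Proof. by rewrite -lecR -rnormE normr_ge0. Qed.

Lemma rnormD u v : rnorm (u + v) <= rnorm u + rnorm v.
Proof. by rewrite -lecR rmorphD /= -!rnormE ler_normD. Qed.

Lemma rnormN u : rnorm (- u) = rnorm u.
Proof. by rewrite /rnorm normrN. Qed.

Lemma rnormZ z u : rnorm (z *: u) = normc z * rnorm u.
Proof.
by apply: complexI; rewrite rmorphM/= -Defs.normcE -!rnormE normrZ.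
Qed.

(** This a priori estimate makes sense whether or not [z] is in the resolvent set, passes from a
    core to its closure, and bounds the resolvent when there is one. *)
Definition lower_bounded A z (C : R) :=
  forall u v, A (u, v) -> rnorm u <= C * rnorm (v - z *: u).

Lemma lower_bounded_le A z C C' :
  C <= C' -> lower_bounded A z C -> lower_bounded A z C'.
Proof.
move=> CC' AC u v /AC /le_trans; apply.
by rewrite ler_wpM2r ?rnorm_ge0.
Qed.

Lemma lower_bounded_closure A z C : 0 <= C ->
  lower_bounded A z C -> lower_bounded (closure A) z C.
Proof.
move=> C0 AC u v uvA; apply/ler_addgt0Pr => e e0.
(* Errors below [e / k] in both components change the estimate by at most
   [e / k * (1 + C * (1 + |z|)) = e]. *)
pose k := 1 + C * (1 + normc z).
have k0 : 0 < k by rewrite ltr_wpDr// mulr_ge0// addr_ge0// normc_ge0.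
have ek0 : 0 < (e / k)%:C by rewrite ltcR divr_gt0.
have [[u' v'] [A' [/= uu' vv']]] := uvA _ (nbhsx_ballx (u, v) _ ek0).
have {}uu' : rnorm (u - u') < e / k.
  by rewrite -ltcR -rnormE; move: uu'; rewrite -ball_normE.
have {}vv' : rnorm (v' - v) < e / k.
  by rewrite -ltcR -rnormE -normrN opprB; move: vv'; rewrite -ball_normE.
have h1 : rnorm u <= rnorm u' + rnorm (u - u').
  by rewrite -{1}(subrK u' u) addrC rnormD.
have h2 : rnorm (v' - z *: u') <=
    rnorm (v - z *: u) + (rnorm (v' - v) + normc z * rnorm (u - u')).
  have -> : v' - z *: u' = (v - z *: u) + ((v' - v) + z *: (u - u')).
    by rewrite scalerBr addrACA (addrC v) subrK [- _ + _]addrA addNr sub0r.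
  rewrite (le_trans (rnormD _ _))// lerD2l (le_trans (rnormD _ _))//.
  by rewrite rnormZ.
have h3 : C * rnorm (v' - z *: u') <= C * (rnorm (v - z *: u) + e / k * (1 + normc z)).
  apply: ler_wpM2l => //; rewrite (le_trans h2)// lerD2l mulrDr mulr1.
  apply: lerD; first exact: ltW.
  by rewrite mulrC ler_wpM2r ?normc_ge0// ltW.
rewrite (le_trans h1)// (le_trans (lerD (AC _ _ A') (ltW uu')))//.
rewrite (le_trans (lerD h3 (lexx _)))// mulrDr -addrA lerD2l.
rewrite le_eqVlt; apply/orP; left; apply/eqP.
by rewrite /k; field; rewrite gt_eqF.
Qed.

Lemma opnorm_le A z (B : {linear E -> E}) C : 0 <= C ->
  is_resolvent A z B -> lower_bounded A z C -> (opnorm B <= C%:E)%E.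
Proof.
move=> C0 [_ AB _] AC; apply: ge_ereal_sup => _ [x /= x1 <-].
rewrite lee_fin -/(rnorm (B x)) (le_trans (AC _ _ (AB x)))//.
rewrite addrAC subrr sub0r rnormN ler_piMr//.
by rewrite -lecR -rnormE.
Qed.

(** If [M] bounds the resolvent at [z], then [C = 2 * M] works: for [|z - w| < 1 / (2 * M)] the
    perturbation costs at most half of [rnorm u], which is absorbed. *)
Lemma lower_bounded_resolvent A z : resolvent_set A z ->
  exists C, 0 < C /\
    forall w, normc (z - w) < C^-1 -> lower_bounded A w C.
Proof.
move=> [B [Bc _ BA]].
have [M M0 BM] : exists2 M : R, 0 < M & forall x, rnorm (B x) <= M * rnorm x.
  have /pinfty_ex_gt0[r r0 Br] :=
    iffLR (linear_boundedP B) (continuous_linear_bounded 0 (Bc 0)).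
  have rE : r = (complex.Re r)%:C.
    by case: r r0 {Br} => a b; rewrite ltcE /= => /andP[/eqP->].
  exists (complex.Re r); first by rewrite -ltcR -rE.
  by move=> x; rewrite -lecR rmorphM /= -!rnormE -rE.
exists (2 * M); split; first by rewrite mulr_gt0.
move=> w zw u v Auv.
have h1 : rnorm u <= M * rnorm (z *: u - v) by rewrite -{1}(BA _ _ Auv) BM.
have h2 : rnorm (z *: u - v) <= rnorm (v - w *: u) + normc (z - w) * rnorm u.
  have -> : z *: u - v = - (v - w *: u) + (z - w) *: u.
    by rewrite opprB scalerBl [RHS]addrC addrA subrK.
  by rewrite (le_trans (rnormD _ _))// rnormN rnormZ.
have h3 : M * (normc (z - w) * rnorm u) <= rnorm u / 2.
  rewrite mulrA [leRHS]mulrC ler_wpM2r ?rnorm_ge0//.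
  rewrite mulrC -ler_pdivlMr// -invfM ltW//.
have := ler_wpM2l (ltW M0) h2; rewrite mulrDr.
lra.
Qed.

(** Each point has a neighbourhood on which one alternative holds with a fixed constant; compactness
    of the rectangle makes the constant uniform. *)
Lemma spectrum_dichotomy_rectangle A (a b S delta : R) : 0 < delta ->
  exists2 C, 0 < C & forall x y, a <= x <= b -> - S <= y <= S ->
    (exists2 l, spectrum A l & normc ((x +i* y) - l) < delta) \/
    lower_bounded A (x +i* y) C.
Proof.
move=> delta0.
pose P C (w : R * R) :=
  (exists2 l, spectrum A l & normc ((w.1 +i* w.2) - l) < delta) \/
  lower_bounded A (w.1 +i* w.2) C.
have cK : compact (`[a, b]%classic `*` `[- S, S]%classic).
  by apply: compact_setX; exact: segment_compact.
(* The radius is halved because balls of [R * R] are for the max norm, while [normc] is bounded by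
   the sum of the coordinates. *)
have ball_normc (w w' : R * R) e : ball w (e / 2) w' ->
    normc ((w'.1 +i* w'.2) - (w.1 +i* w.2)) < e.
  move=> -[w1 w2].
  have -> : (w'.1 +i* w'.2) - (w.1 +i* w.2) = (w'.1 - w.1) +i* (w'.2 - w.2) by [].
  rewrite (le_lt_trans (normc_le_norm _ _))//.
  by rewrite distrC [X in _ + X]distrC (splitr e); exact: ltrD.
have locP w : exists2 e : R, 0 < e & exists C0,
    forall w' C, ball w e w' -> C0 <= C -> P C w'.
  have [[l Al wl]|Nl] := pselect
      (exists2 l, spectrum A l & normc ((w.1 +i* w.2) - l) < delta).
    exists ((delta - normc ((w.1 +i* w.2) - l)) / 2).
      by rewrite divr_gt0// subr_gt0.
    exists 0 => w' C /ball_normc ww' _; left; exists l => //.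
    rewrite -(subrK (w.1 +i* w.2) (w'.1 +i* w'.2)) -addrA.
    by rewrite (le_lt_trans (ler_normcD _ _))// -ltrBrDr.
  have /contrapT/lower_bounded_resolvent[C0 [C00 AC0]] :
      ~ ~ resolvent_set A (w.1 +i* w.2).
    by move=> Aw; apply: Nl; exists (w.1 +i* w.2) => //; rewrite subrr normc0.
  exists (C0^-1 / 2); first by rewrite divr_gt0// invr_gt0.
  exists C0 => w' C /ball_normc ww' C0C; right.
  apply: (lower_bounded_le C0C); apply: AC0.
  by rewrite -opprB normcN.
(* The finite subcover is taken in filter form, with [C] tending to infinity; this is why [locP]
   covers every [C] above [C0]. *)
have := iffLR (compact_near_coveringP _) cK _ (pinfty_nbhs R) P _ _.
case.
- move=> w _; have [e e0 [C0 wC0]] := locP w.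
  exists (ball w e, [set C | C0 <= C]).
    by split => /=; [exact: nbhsx_ballx|apply: nbhs_pinfty_ge; exact: num_real].
  by move=> [w' C] [/= ww' CC0]; exact: wC0.
- move=> C0 [_ KP].
  have C1 : C0 < `|C0| + 1 by rewrite (le_lt_trans (ler_norm _))// ltrDl.
  exists (`|C0| + 1); first by rewrite ltr_wpDl.
  by move=> x y xab yS; apply: (KP _ C1 (x, y)); split; rewrite /= in_itv.
Qed.

End real_norm.

(** * The Schrodinger operator *)

Section schrodinger_bounds.
Local Open Scope complex_scope.
Context (R : realType) (n : nat).
Local Notation leb := (lebesgue_rV R n).
Variable V : 'rV[R]_n -> R[i].

Lemma rnorm_L2class (f : L2fun leb) : rnorm (L2class f) = L2norm f.
Proof. by rewrite /rnorm normL2E. Qed.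

(** Integration removes the divergence and gives [|u|^2 <= 2 C |(H - z) u|^2] on test functions;
    [2 * C + 1] bounds the square root of [2 * C]. *)
Lemma lower_bounded_schrodinger (z : R[i]) (t al be C : R) : 0 < t -> 0 <= C ->
  (forall phi, test_function phi -> {ae leb, forall x,
    normc (phi x) ^+ 2 / 2 <=
      C * normc (- laplacian phi x + V x * phi x - z * phi x) ^+ 2
      + \sum_i dflux t al be (@complex.Re R \o phi) (@complex.Im R \o phi) i x}) ->
  lower_bounded (schrodinger V) z (2 * C + 1).
Proof.
move=> t0 C0 phiV; apply: lower_bounded_closure; first by rewrite addr_ge0 ?mulr_ge0.
move=> u v [phi [tphi /= uphi vphi]].
have [sp sq _] := tphi; have [r r0 phir] := test_function_cube tphi.
have pq0 x : ~ cube r x ->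
    (@complex.Re R \o phi) x = 0 /\ (@complex.Im R \o phi) x = 0.
  move=> xr; suff phi0 : phi x = 0 by rewrite /= phi0.
  by apply/eqP/negPn/negP => /phir.
have [iD D0] := integral_dflux al be t0 (sp 2) (sq 2) r0 pq0.
pose w : L2fun leb := repr v - z *: repr u.
have vzu : v - z *: u = L2class w.
  by rewrite /w raddfB /= linearZ /= !L2reprK.
have key : L2norm (repr u) ^+ 2 / 2 <= C * L2norm w ^+ 2.
  apply: (L2norm_le_divergence iD D0).
  have := phiV _ tphi; apply: filterS3 uphi vphi => x ux vx.
  have -> : (repr u : L2fun leb) x = phi x by exact: ux.
  by have -> : w x = - laplacian phi x + V x * phi x - z * phi x
    by rewrite /w L2funDE L2funNE L2funZE; congr (_ - z * _); [exact: vx|exact: ux].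
rewrite vzu -{1}(L2reprK u) !rnorm_L2class.
rewrite -ler_sqr ?nnegrE ?mulr_ge0 ?addr_ge0 ?mulr_ge0 ?L2norm_ge0//.
have := sqr_ge0 (L2norm w); rewrite exprMn; nra.
Qed.

Local Notation Rep phi := (@complex.Re R \o phi).
Local Notation Imp phi := (@complex.Im R \o phi).
Local Notation lap f x := (\sum_i pderiv i (pderiv i f) x).

Lemma sqr_normc (w : R[i]) : normc w ^+ 2 = complex.Re w ^+ 2 + complex.Im w ^+ 2.
Proof. by case: w => a b /=; rewrite sqr_sqrtr// addr_ge0 ?sqr_ge0. Qed.

Lemma Im_le_normc (w : R[i]) : `|complex.Im w| <= normc w.
Proof.
rewrite -ler_sqr ?nnegrE ?normc_ge0// real_normK ?num_real// sqr_normc.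
by rewrite lerDr sqr_ge0.
Qed.

Lemma laplacianE (phi : 'rV[R]_n -> R[i]) x :
  laplacian phi x = lap (Rep phi) x +i* lap (Imp phi) x.
Proof.
by apply/eqP; rewrite eq_complex; apply/andP; split; apply/eqP; exact: raddf_sum.
Qed.

Lemma residual_sqr (z : R[i]) (phi : 'rV[R]_n -> R[i]) x :
  normc (- laplacian phi x + V x * phi x - z * phi x) ^+ 2 =
  (- lap (Rep phi) x
   + (complex.Re (V x) * Rep phi x - complex.Im (V x) * Imp phi x)
   - (complex.Re z * Rep phi x - complex.Im z * Imp phi x)) ^+ 2
  + (- lap (Imp phi) x
   + (complex.Re (V x) * Imp phi x + complex.Im (V x) * Rep phi x)
   - (complex.Re z * Imp phi x + complex.Im z * Rep phi x)) ^+ 2.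
Proof.
by rewrite sqr_normc laplacianE /=; case: (V x) (phi x) z => ? ? [? ?] [? ?].
Qed.

Hypothesis ReV_ge0 : {ae leb, forall x, 0 <= complex.Re (V x)}.

(** Here [Re (V - z) >= 1], so the energy inequality alone gives [m / 2 <= F / 2] up to a
    divergence; the coefficients 1 and 0 select the energy flux. *)
Lemma left_half_plane_bound (z : R[i]) : complex.Re z <= -1 ->
  lower_bounded (schrodinger V) z 2.
Proof.
move=> z1; have -> : 2 = 2 * 2^-1 + 1 :> R by field.
apply: (@lower_bounded_schrodinger z 1 1 0) => // phi _.
apply: filterS ReV_ge0 => x Vx; rewrite residual_sqr sum_dflux sqr_normc.
set g := \sum_i (_ + _); rewrite mul0r subr0 mul1r.
have g0 : 0 <= g by apply: sumr_ge0 => i _; rewrite addr_ge0 ?sqr_ge0.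
have := energy_ineq (Rep phi x) (Imp phi x) (lap (Rep phi) x) (lap (Imp phi) x)
  (complex.Re (V x)) (complex.Im (V x)) (complex.Re z) (complex.Im z) g.
rewrite [2^-1 * _]mulrC; set F := (X in X / 2).
set m := _ ^+ 2 + _ ^+ 2; have m0 : 0 <= m by rewrite addr_ge0 ?sqr_ge0.
set dA := g + _ + _ => h; clearbody g m dA F.
have h1 : 1 * m <= (complex.Re (V x) - complex.Re z) * m.
  by apply: ler_wpM2r => //; lra.
lra.
Qed.

Hypothesis V_loc : Linfty_loc V.
Variables c d : R.
Hypotheses (c0 : 0 < c) (d0 : 0 < d).
Hypothesis ReV_growth :
  {ae leb, forall x, c * enorm x ^+ 2 - d <= complex.Re (V x)}.

Lemma high_frequency_bound (r : R) : 0 < r ->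
  exists S C : R, 0 < C /\ forall z, complex.Re z <= r ->
    S <= `|complex.Im z| -> lower_bounded (schrodinger V) z C.
Proof.
(* [K] collects [Re z <= r], the loss [d] in the growth of [Re V] and the 1/2 from Young's
   inequality. The choice of [t] makes [a * K = 1/8]. *)
move=> r0; pose K : R := r + d + 2^-1; pose t : R := 32 * K / c; pose E : R := 16 / t.
have K0 : 0 < K by rewrite !addr_gt0// invr_gt0.
have t0 : 0 < t by rewrite divr_gt0// mulr_gt0.
have [_ /(_ _ (@compact_cube R n (t + 1)))[M0 VM0]] := V_loc.
pose M : R := `|M0|; pose a : R := 4 / (c * t).
have a0 : 0 <= a by rewrite divr_ge0// mulr_ge0// ltW.
have M_ge0 : 0 <= M by exact: normr_ge0.
(* Chosen after [t] and the bound [M] of [V] on the support of the cutoff, [S] yields both [b <= 1]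
   and [b * (2 * M + 1 + E + K) <= 1/4]. *)
pose S : R := 1 + 4 * (2 * M + 1 + E + K).
have L0 : 0 < 2 * M + 1 + E + K.
  apply: addr_gt0 => //; apply: addr_gt0; last by rewrite divr_gt0.
  by apply: ltr_wpDl => //; apply: mulr_ge0 => //; exact: normr_ge0.
exists S, (2 * (3 / 2 + a / 2) + 1); split.
  by rewrite addr_gt0// mulr_gt0// ltr_pwDl// divr_ge0.
move=> z zr zS; pose s := complex.Im z; pose sg := Num.sg s; pose b : R := `|s|^-1.
have S0 : 0 < `|s| by apply: lt_le_trans zS; rewrite /S; lra.
have b1 : b <= 1.
  by rewrite /b invf_le1//; apply: le_trans zS; rewrite /S; lra.
have bM : b * (2 * M + 1 + E + K) <= 4^-1.
  rewrite /b mulrC ler_pdivrMr//; move: zS; rewrite /S -/s; lra.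
have sgs : sg * s = `|s| by rewrite normrEsg.
have sg2 : sg ^+ 2 = 1 by rewrite sqr_sg; move: S0; rewrite normr_gt0 => ->.
(* The flux coefficients are those of [dA] and [dB] in [absorption], with the sign of [Im z]
   included in the second. *)
apply: (@lower_bounded_schrodinger z t (b + a) (2 * b * sg)) => //.
  by rewrite addr_ge0// divr_ge0.
move=> phi _; apply: filterS2 VM0 ReV_growth => x Vx Vg.
rewrite residual_sqr sum_dflux sqr_normc.
set g := \sum_i (_ + _); set eb := \sum_i _ * _.
set y := cutoff t x.
have y0 : 0 <= y by exact: cutoff_ge0.
have y1 : y <= 1 by exact: cutoff_le1.
rewrite -[2 * b * sg * _]mulrA.
apply: (@absorption _ _ _ _ _ (complex.Re (V x)) (complex.Im (V x)) (complex.Re z)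
  `|s| g eb y (sqnorm x) a b c d r t M E K) => //.
- by rewrite addr_ge0 ?sqr_ge0.
- by rewrite addr_ge0 ?sqr_ge0.
- by apply: sumr_ge0 => i _; rewrite addr_ge0 ?sqr_ge0.
- exact: energy_ineq.
- by rewrite -sgs; apply: cutoff_ineq => //; rewrite y0.
- exact: cutoff_flux_le.
- have [->|/(cutoff_support t0) yx] := eqVneq y 0; first by rewrite mul0r.
  rewrite (le_trans (ler_piMl _ y1))// (le_trans (Im_le_normc _))//.
  by rewrite (le_trans (Vx yx))// ler_norm.
- exact: sqnorm_ge0.
- exact: cutoff_ge_half.
- by move: Vg; rewrite /enorm sqr_sqrtr//; exact: sqnorm_ge0.
- by rewrite /a /t le_eqVlt; apply/orP; left; apply/eqP; field; rewrite !gt_eqF.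
Qed.

End schrodinger_bounds.

(** * From the three lower bounds to the pseudospectral inclusion *)

Theorem theorem2p4 (R : realType) (n : nat) (n_ge1 : (1 <= n)%N)
    (V : 'rV[R]_n -> R[i]) (gradV : 'I_n -> 'rV[R]_n -> R[i])
    (V_W1infty : W1infty_loc V gradV)
    (ReV_ge0 : {ae lebesgue_rV R n, forall x, 0 <= complex.Re (V x)})
    (gradV_bound : exists a b : R, [/\ 0 < a, 0 < b &
      {ae lebesgue_rV R n, forall x,
        \sum_i normc (gradV i x) ^+ 2 <= a + b * normc (V x) ^+ 2}])
    (V_infty : forall M : R, exists r : R,
      {ae lebesgue_rV R n, forall x, r <= enorm x -> M <= normc (V x)})
    (ReV_growth : exists c d : R, [/\ 0 < c, 0 < d &
      {ae lebesgue_rV R n, forall x,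
        c * enorm x ^+ 2 - d <= complex.Re (V x)}]) :
  forall delta r : R, 0 < delta -> 0 < r ->
    exists2 e : R, 0 < e &
      pseudospectrum (schrodinger V) e `<=`
        [set z | r <= complex.Re z] `|`
        \bigcup_(l in spectrum (schrodinger V)) [set z | normc (z - l) < delta].
Proof.
have [c [d [c0 d0 ReV_cd]]] := ReV_growth.
move=> delta r delta0 r0.
have [S [C1 [C10 high]]] := high_frequency_bound V_W1infty.1 c0 d0 ReV_cd r0.
(* The rectangle covers what remains of [Re z < r] once the left half-plane and the region of large
   [|Im z|] are removed. *)
have [C2 C20 mid] :=
  spectrum_dichotomy_rectangle (schrodinger V) (-1) r S delta0.
pose C := C1 + C2 + 2.
have C0 : 0 < C by rewrite !addr_gt0.
have CC (C' : R) : C' = C1 \/ C' = C2 \/ C' = 2 -> C' <= C.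
  by rewrite /C => -[->|[->|->]]; lra.
(* With this [e], a pseudospectral point outside the spectrum has [opnorm B > C], which excludes a
   lower bound with constant [C]. *)
exists C^-1; first by rewrite invr_gt0.
move=> z [zV|[B zB]]; first by right; exists z => //=; rewrite subrr normc0.
rewrite invrK => CB.
have [rz|zr] := leP r (complex.Re z); first by left.
have not_lower : ~ lower_bounded (schrodinger V) z C.
  by move=> /(opnorm_le (ltW C0) zB); rewrite leNgt CB.
have [z1|z1] := leP (complex.Re z) (-1).
  exfalso; apply: not_lower; apply: lower_bounded_le (left_half_plane_bound ReV_ge0 z1).
  by apply: CC; right; right.
have [Sz|zS] := leP S `|complex.Im z|.
  exfalso; apply: not_lower; apply: lower_bounded_le (high _ (ltW zr) Sz).
  by apply: CC; left.
have zE : z = (complex.Re z +i* complex.Im z)%C by case: (z).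
right; have [||[l lV lz]|zC2] := mid (complex.Re z) (complex.Im z).
- by rewrite !ltW.
- by rewrite -ler_norml ltW.
- by exists l => //=; rewrite zE.
- exfalso; apply: not_lower; apply: (@lower_bounded_le _ _ _ _ C2).
    by apply: CC; right; left.
  by rewrite zE.
Qed.
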